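(* For $|q|<1$ (with $q\neq 0$ where negative powers of $q$ occur), the following identities hold, where all sums run over integers $i,j,k\ge 0$: \begin{align*} \sum_{i,j,k\geq 0} \frac{q^{2i^2+2j^2+k^2-2ij-2jk}}{(q^2;q^2)_i(q^2;q^2)_j(q^2;q^2)_k}&=\frac{J_4^5J_{40}}{J_1J_2^2J_8^2J_{8,40}}+2q\frac{J_8^2J_{6,20}J_{8,40}}{J_1J_4^2J_{40}}, \\ \sum_{i,j,k\geq 0} \frac{q^{i^2+j^2+\frac{1}{2}(k^2+k)-ij-jk}}{(q;q)_i(q;q)_j(q;q)_k} &=\frac{J_2^6J_{1,10}J_{8,20}}{J_1^5J_4^2J_{20}}+2q\frac{J_4^2J_{4,10}J_{2,20}}{J_1^3J_{20}}, \\ \sum_{i,j,k\geq 0} \frac{q^{i^2+j^2+\frac{1}{2}(k^2+k)-ij-jk+i-j}}{(q;q)_i(q;q)_j(q;q)_k} &=2\frac{J_2J_4^2J_{20}}{J_1^3J_{4,20}}+\frac{J_2^6J_{3,10}J_{4,20}}{J_1^5J_4^2J_{20}}, \\ \sum_{i,j,k\geq 0} \frac{q^{2i^2+2j^2+k^2-2ij-2jk-2i+2j}}{(q^2;q^2)_i(q^2;q^2)_j(q^2;q^2)_k} &=2\frac{J_8^2J_{2,20}J_{16,40}}{J_1J_4^2J_{40}}+q\frac{J_4^4J_{8,20}J_{4,40}}{J_1J_2^2J_8^2J_{40}}, \\ \sum_{i,j,k\geq 0} \frac{q^{i^2+j^2+\frac{1}{2}(k^2-k)-ij-jk-i+j}}{(q;q)_i(q;q)_j(q;q)_k}&=4\frac{J_2J_4^2J_{20}}{J_1^3J_{4,20}}+2\frac{J_2^6J_{3,10}J_{4,20}}{J_1^5J_4^2J_{20}},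 \\ \sum_{i,j,k\geq 0} \frac{q^{i^2+j^2+\frac{1}{2}(k^2-k)-ij-jk-2i+2j}}{(q;q)_i(q;q)_j(q;q)_k} &=2q^{-1}\frac{J_2^6J_{1,10}J_{8,20}}{J_1^5J_4^2J_{20}}+4\frac{J_4^2J_{4,10}J_{2,20}}{J_1^3J_{20}}. \end{align*}
   Context: Notation, for $|q|<1$: $(a;q)_0:=1$, $(a;q)_n:=\prod_{k=0}^{n-1}(1-aq^k)$ for $n\ge 1$, $(a;q)_\infty:=\prod_{k=0}^\infty(1-aq^k)$, and $(a_1,\dots,a_m;q)_\infty:=(a_1;q)_\infty\cdots(a_m;q)_\infty$. For positive integers $m$ and $0<a<m$, $$J_m:=(q^m;q^m)_\infty,\qquad J_{a,m}:=(q^a,q^{m-a},q^m;q^m)_\infty .$$ *)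

(* Defs.v *)
From HB Require Import structures.
From mathcomp Require Import all_boot all_order all_algebra finmap.
From mathcomp Require Import all_classical all_reals all_analysis.
From mathcomp Require Import summability.

Set Implicit Arguments.
Unset Strict Implicit.
Unset Printing Implicit Defensive.

Import Order.TTheory GRing.Theory Num.Theory numFieldNormedType.Exports.

Local Open Scope classical_set_scope.
Local Open Scope ring_scope.

Section QSeries.
Context {K : numFieldType}.
Implicit Types a q S : K.

Definition qpoch a q (n : nat) : K := \prod_(k < n) (1 - a * q ^+ k).

Definition qpoch_inf a q : K := lim (qpoch a q n @[n --> \oo]).

Definition qpoch_infs (s : seq K) q : K := \prod_(a <- s) qpoch_inf a q.

Definition etaJ q (m : nat) : K := qpoch_inf (q ^+ m) (q ^+ m).

(* [m - a] is truncated subtraction: only meaningful for 0 < a < m. *)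
Definition thetaJ q (a m : nat) : K :=
  qpoch_infs [:: q ^+ a; q ^+ (m - a); q ^+ m] (q ^+ m).

(* Unconditional summability of the family with sum [S]: the finite partial
   sums converge to [S] along the finite subsets of nat * nat * nat, directed
   by inclusion.  Over the complex numbers this amounts to absolute
   convergence, so no order of summation has to be fixed. *)
Definition has_sum3 (f : nat -> nat -> nat -> K) S : Prop :=
  partial_sum (fun t : nat * nat * nat => f t.1.1 t.1.2 t.2) @ totally --> S.

End QSeries.

(* Main.v *)
(* With base Q, the triple sum of Q^(i^2 + j^2 + k(k-1)/2 - ij - jk) y^k w^(i-j)
   / ((Q)_i (Q)_j (Q)_k) becomes, after summing over k by Euler's identity, expanding
   the resulting finite product by the q-binomial theorem and summing along a
   diagonal by Durfee's identity, the double sum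
     (-y)_oo / (Q)_oo * sum_(d in Z, l >= 0) Q^(d^2 + dl + l(l-1)/2) w^(-d-l) y^l / (Q)_l.
   Completing the square in d separates the variables according to the parity of l:
   each part is a theta series (phi or psi) times one of the Rogers-Slater sums
   sum Q^(n^2) / (Q)_(2n), sum Q^(n^2+n) / (Q)_(2n), sum Q^(n^2+n) / (Q)_(2n+1),
   sum Q^(n^2+2n) / (Q)_(2n+1) (79, 99, 94 and 96 in Slater's list).
   These follow from finite identities expressing 1/(q)_(2n) and 1/(q)_(2n+1) as
   alternating sums of products 1/((q)_a (q)_b), from Durfee's identity again, and
   from the quintuple product identity.
   At q = 0 the sums are finite and count the zeros of the exponent. *)

Require Import Defs.
From HB Require Import structures.
From mathcomp Require Import all_boot all_order all_algebra finmap.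
From mathcomp Require Import complex.
From mathcomp Require Import all_classical all_reals all_analysis.
From mathcomp Require Import summability.
From mathcomp Require Import zify ring lra.

Set Implicit Arguments.
Unset Strict Implicit.
Unset Printing Implicit Defensive.

Import Order.TTheory GRing.Theory Num.Theory numFieldNormedType.Exports.

Local Open Scope fset_scope.
Local Open Scope ring_scope.

Local Open Scope complex_scope.

(** * Unconditional sums over arbitrary index sets *)

Section UnconditionalSums.
Variable K : numFieldType.

(** The Rogers-Slater sums enter only through z = y^2 / w: z = Q gives 79 and 94, z = Q^2 gives 99
    and 96. The six identities are the choices (Q, y, w) = (q^2, q, 1), (q, q, 1), (q, q, q), (q^2,
    q, q^-2), (q, 1, q^-1), (q, 1, q^-2), for which the prefactor (-y; Q)_oo and the theta series in
    w are also quotients of the products J_m, up to powers of q. For y = 1 the prefactor is (-1)_oo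
    = 2 (-q)_oo, hence the doubled right-hand sides. The delicate point is rearrangement: expanding
    the product left by the sum over k brings in negative exponents, so the expanded family gets a
    summability estimate of its own. Every family is bounded by powers |q|^E with an integer
    exponent E, and summability becomes a comparison of E with the square of the size of the index.
    Summability yields the existence of a sum; uniqueness then allows its value to be computed in
    any convenient order. *)

Definition fsum (I : choiceType) (f : I -> K) (A : {fset I}) : K :=
  \sum_(i <- A) f i.

Definition has_sum (I : choiceType) (f : I -> K) (S : K) : Prop :=
  forall e, 0 < e -> exists A : {fset I},
    forall B : {fset I}, A `<=` B -> `|fsum f B - S| < e.

Definition abs_summable (I : choiceType) (f : I -> K) : Prop :=
  exists M, forall A : {fset I}, \sum_(i <- A) `|f i| <= M.

Definition seq_cvg (s : nat -> K) (S : K) : Prop :=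
  forall e, 0 < e -> exists N, forall n, (N <= n)%N -> `|s n - S| < e.

Lemma norm_lt_eq0 (x : K) : (forall e, 0 < e -> `|x| < e) -> x = 0.
Proof.
move=> h; apply/eqP/negPn/negP => x0.
by have := h `|x|; rewrite normr_gt0 x0 ltxx => /(_ isT).
Qed.

Lemma has_sum_unique (I : choiceType) (f : I -> K) S T :
  has_sum f S -> has_sum f T -> S = T.
Proof.
move=> fS fT; apply/eqP; rewrite -subr_eq0; apply/eqP/norm_lt_eq0 => e e0.
have e2 : 0 < e / 2 by rewrite divr_gt0.
have [A hA] := fS _ e2; have [B hB] := fT _ e2.
have {hA} := hA (A `|` B) (fsubsetUl _ _).
have {hB} := hB (A `|` B) (fsubsetUr _ _).
move=> h1 h2; rewrite (splitr e).
rewrite (_ : S - T = (fsum f (A `|` B) - T) - (fsum f (A `|` B) - S)); last by ring.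
by rewrite (le_lt_trans (ler_normB _ _))// ltrD.
Qed.

Lemma seq_cvg_unique s S T : seq_cvg s S -> seq_cvg s T -> S = T.
Proof.
move=> fS fT; apply/eqP; rewrite -subr_eq0; apply/eqP/norm_lt_eq0 => e e0.
have e2 : 0 < e / 2 by rewrite divr_gt0.
have [A hA] := fS _ e2; have [B hB] := fT _ e2.
have {hA} := hA (maxn A B) (leq_maxl _ _).
have {hB} := hB (maxn A B) (leq_maxr _ _).
move=> h1 h2; rewrite (splitr e).
rewrite (_ : S - T = (s (maxn A B) - T) - (s (maxn A B) - S)); last by ring.
by rewrite (le_lt_trans (ler_normB _ _))// ltrD.
Qed.

Lemma eq_has_sum (I : choiceType) (f g : I -> K) S :
  f =1 g -> has_sum f S -> has_sum g S.
Proof. by move=> /funext ->. Qed.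

Lemma has_sumD (I : choiceType) (f g : I -> K) S T :
  has_sum f S -> has_sum g T -> has_sum (fun x => f x + g x) (S + T).
Proof.
move=> fS gT e e0; have e2 : 0 < e / 2 by rewrite divr_gt0.
have [A hA] := fS _ e2; have [B hB] := gT _ e2.
exists (A `|` B) => C; rewrite fsubUset => /andP[AC BC].
rewrite /fsum big_split/= (splitr e).
rewrite (_ : _ + _ - _ = (fsum f C - S) + (fsum g C - T)); last by rewrite /fsum; ring.
by rewrite (le_lt_trans (ler_normD _ _))// ltrD ?hA ?hB.
Qed.

Lemma has_sumZ (I : choiceType) (f : I -> K) c S :
  has_sum f S -> has_sum (fun x => c * f x) (c * S).
Proof.
move=> fS e e0; have [->|c0] := eqVneq c 0.
  by exists fset0 => B _; rewrite /fsum -mulr_sumr !mul0r subr0 normr0.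
have ce : 0 < e / `|c| by rewrite divr_gt0// normr_gt0.
have [A hA] := fS _ ce; exists A => B /hA.
by rewrite /fsum -mulr_sumr -mulrBr normrM ltr_pdivlMr ?normr_gt0// mulrC.
Qed.

Lemma has_sum_finite (I : choiceType) (f : I -> K) (A : {fset I}) :
  (forall x, x \notin A -> f x = 0) -> has_sum f (fsum f A).
Proof.
move=> f0 e e0; exists A => B AB.
rewrite (_ : fsum f B = fsum f A) ?subrr ?normr0//.
by rewrite /fsum; apply/esym/big_fset_incl => // x _ /f0.
Qed.

Lemma has_sum_single (I : choiceType) (f : I -> K) (a : I) :
  (forall x, x != a -> f x = 0) -> has_sum f (f a).
Proof.
move=> f0; rewrite -[f a](big_seq_fset1 +%R a f).
by apply: has_sum_finite => x; rewrite inE => /f0.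
Qed.

Lemma has_sum0 (I : choiceType) (f : I -> K) : f =1 (fun=> 0) -> has_sum f 0.
Proof.
move=> f0; rewrite -(big_seq_fset0 +%R f).
by apply: has_sum_finite => x _; rewrite f0.
Qed.

Lemma has_sum_inj (I J : choiceType) (h : I -> J) (f : J -> K) S :
  injective h -> (forall y, (forall x, h x <> y) -> f y = 0) ->
  has_sum f S <-> has_sum (f \o h) S.
Proof.
move=> hi f0.
have E (A : {fset I}) : fsum f (h @` A) = fsum (f \o h) A.
  by rewrite /fsum big_imfset//= => x y _ _ /hi.
split=> fS e e0.
  have [A hA] := fS e e0.
  (* The fibre of [h] over [x], empty or a singleton; the union over [A] is then the finite preimage
     of [A]. *)
  pose g (x : J) : {fset I} :=
    if pselect (exists y, h y = x) is left e then [fset projT1 (cid e)] else fset0.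
  pose A' : {fset I} := \bigcup_(x <- A) g x.
  have gA x : h x \in A -> x \in A'.
    move=> hx; apply/bigfcupP; exists (h x); rewrite ?hx//.
    rewrite /g; case: pselect => [p|[]]; last by exists x.
    by rewrite inE; case: cid => /= z /hi ->.
  exists A' => B AB; rewrite -E.
  have -> : fsum f (h @` B) = fsum f (A `|` (h @` B)).
    rewrite /fsum; apply: big_fset_incl; first exact: fsubsetUr.
    move=> y; rewrite inE => /orP[yA yB|->//].
    apply: f0 => x xy; move/negP: yB; apply; apply/imfsetP; exists x => //=.
    by apply: (fsubsetP AB); apply: gA; rewrite xy.
  by apply: hA; exact: fsubsetUl.
have [A hA] := fS e e0; exists (h @` A) => B AB.
pose g (x : J) : {fset I} :=
  if pselect (exists y, h y = x) is left e then [fset projT1 (cid e)] else fset0.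
pose B' : {fset I} := \bigcup_(x <- B) g x.
have gB x : (h x \in B) = (x \in B').
  apply/idP/bigfcupP => [hx|[y]].
    exists (h x); rewrite ?hx// /g; case: pselect => [p|[]]; last by exists x.
    by rewrite inE; case: cid => /= z /hi ->.
  rewrite andbT => yB; rewrite /g; case: pselect => // p; rewrite inE => /eqP ->.
  by case: cid => /= z ->.
have -> : fsum f B = fsum f (h @` B').
  rewrite /fsum; apply/esym/big_fset_incl.
    by apply/fsubsetP => y /imfsetP[x /= xB ->]; rewrite gB.
  move=> y yB yB'; apply: f0 => x xy; move/negP: yB'; apply.
  by apply/imfsetP; exists x => //=; rewrite -gB xy.
rewrite E; apply: hA; apply/fsubsetP => x xA; rewrite -gB.
by apply: (fsubsetP AB); apply/imfsetP; exists x.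
Qed.

Lemma has_sum_bij (I J : choiceType) (h : I -> J) (h' : J -> I) (f : J -> K) S :
  cancel h h' -> cancel h' h -> has_sum (f \o h) S -> has_sum f S.
Proof.
move=> hK h'K; apply: (iffRL (has_sum_inj _ _ _)) => [|y /(_ (h' y))[]//].
exact: can_inj hK.
Qed.

End UnconditionalSums.

(** * Summation by fibres and dominated convergence *)

Section UnconditionalSumsTheory.
Variable K : numFieldType.

(** Given a finite [B], each fibre over [B] is cut to a finite set that captures its sum up to an
    equal share of e/2. Together with [A], and restricted to the fibres over [B], these sets form a
    [V] on which the sum of [f] is close both to [S] and to the sum of [g] over [B]. *)
Lemma has_sum_fiber (T I : choiceType) (phi : T -> I) (f : T -> K) (g : I -> K) S :
  has_sum f S ->
  (forall i, has_sum (fun t => if phi t == i then f t else 0) (g i)) ->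
  has_sum g S.
Proof.
move=> fS fg e e0; have e2 : 0 < e / 2 by rewrite divr_gt0.
have [A hA] := fS _ e2; exists (phi @` A) => B AB.
(* The successor keeps the share positive when [B] is empty. *)
pose d := e / 2 / (#|` B|.+1)%:R.
have d0 : 0 < d by rewrite divr_gt0.
have hF i : {F : {fset T} | forall G : {fset T}, F `<=` G ->
    `|fsum (fun t => if phi t == i then f t else 0) G - g i| < d}.
  by apply: cid; exact: (fg i _ d0).
pose F i := projT1 (hF i).
pose U := A `|` \bigcup_(i <- B) F i.
pose V := [fset t in U | phi t \in B].
have AV : A `<=` V.
  apply/fsubsetP => t tA; rewrite !inE tA/=.
  by apply: (fsubsetP AB); apply/imfsetP; exists t.
have E : fsum f V = \sum_(i <- B) fsum (fun t => if phi t == i then f t else 0) U.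
  rewrite /fsum exchange_big/=.
  transitivity (\sum_(t <- U) if phi t \in B then f t else 0).
    by rewrite -big_mkcond/= /V big_fset.
  apply: eq_bigr => t _; case: ifPn => tB.
    rewrite (big_fsetD1 (phi t))//= eqxx big_seq big1 ?addr0// => i.
    by rewrite !inE eq_sym => /andP[/negPf ->].
  rewrite big_seq big1// => i iB; case: eqP => // ti.
  by rewrite ti iB in tB.
have FU i : i \in B -> F i `<=` U.
  move=> iB; apply: fsubset_trans (fsubsetUr _ _).
  exact: bigfcup_sup.
rewrite (_ : fsum g B - S = (fsum f V - S) - (fsum f V - fsum g B)); last by ring.
rewrite (splitr e) (le_lt_trans (ler_normB _ _))// ltr_leD ?hA//.
rewrite E /fsum -sumrB (le_trans (ler_norm_sum _ _ _))//.
apply: (@le_trans _ _ (\sum_(i <- B) d)).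
  rewrite big_seq [leRHS]big_seq; apply: ler_sum => i iB.
  by apply/ltW/(projT2 (hF i))/FU.
rewrite big_const_seq count_predT iter_addr addr0 /d -[_ *+ #|` _|]mulr_natr -[leLHS]mulrA.
rewrite ler_piMr ?(ltW e2)// mulrC ler_pdivrMr// mul1r ler_nat.
exact: leqnSn.
Qed.

Lemma has_sum_pair (I J : choiceType) (f : I * J -> K) (g : I -> K) S :
  has_sum f S -> (forall i, has_sum (fun j => f (i, j)) (g i)) -> has_sum g S.
Proof.
move=> fS fg; apply: (has_sum_fiber (phi := fst) fS) => i.
apply: (iffRL (@has_sum_inj _ J (I * J)%type (fun j => (i, j)) _ _ _ _)).
- by move=> x y [].
- case=> x y h /=; case: eqP => // xi; by case: (h y); rewrite xi.
- by apply: eq_has_sum (fg i) => j; rewrite /= eqxx.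
Qed.

Lemma ler_sum_fsubset (I : choiceType) (f : I -> K) (A B : {fset I}) :
  (forall x, 0 <= f x) -> A `<=` B -> \sum_(i <- A) f i <= \sum_(i <- B) f i.
Proof.
move=> f0 AB; rewrite [leRHS](big_fsetID _ (mem A))/=.
rewrite (_ : [fset x in B | x \in A] = A); last first.
  apply/fsetP => x; rewrite !inE/= andbC; case xA: (x \in A) => //=.
  exact: (fsubsetP AB).
by rewrite lerDl sumr_ge0.
Qed.

Lemma abs_summable_le (I : choiceType) (f g : I -> K) c :
  (forall x, `|f x| <= c * `|g x|) -> abs_summable g -> abs_summable f.
Proof.
move=> fg [M hM]; exists (`|c| * M) => A.
apply: (@le_trans _ _ (`|c| * \sum_(i <- A) `|g i|)); last first.
  by rewrite ler_wpM2l.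
rewrite mulr_sumr; apply: ler_sum => i _.
apply: le_trans (fg i) _.
have h : 0 <= c * `|g i| by rewrite (le_trans _ (fg i)).
by rewrite -[leLHS]ger0_norm// normrM normr_id.
Qed.

Lemma abs_summable_inj (I J : choiceType) (h : I -> J) (f : J -> K) :
  injective h -> abs_summable f -> abs_summable (f \o h).
Proof.
move=> hi [M hM]; exists M => A; apply: le_trans (hM (h @` A)).
by rewrite big_imfset//= => x y _ _ /hi.
Qed.

Lemma abs_summable_prod (I J : choiceType) (f : I -> K) (g : J -> K) :
  abs_summable f -> abs_summable g ->
  abs_summable (fun t : I * J => f t.1 * g t.2).
Proof.
move=> [M hM] [N hN]; exists (M * N) => A.
pose A1 := fst @` A; pose A2 := snd @` A.
apply: (@le_trans _ _ ((\sum_(i <- A1) `|f i|) * (\sum_(j <- A2) `|g j|))).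
  rewrite big_distrl/=; under [leRHS]eq_bigr do rewrite big_distrr/=.
  have -> : \sum_(i <- A1) \sum_(j <- A2) `|f i| * `|g j| =
     \sum_(p <- A1 `*` A2) `|f p.1| * `|g p.2|.
    rewrite pair_big_dep_cond/=; apply: eq_fbigl => -[x y].
    by rewrite !inE/= !andbT.
  under eq_bigr do rewrite normrM.
  apply: ler_sum_fsubset => [[x y]|]; first by rewrite mulr_ge0.
  apply/fsubsetP => -[x y] xyA; rewrite inE/=; apply/andP; split;
    by apply/imfsetP; exists (x, y).
by apply: ler_pM; rewrite ?sumr_ge0.
Qed.

Lemma abs_summableZ (I : choiceType) (f : I -> K) c :
  abs_summable f -> abs_summable (fun t => c * f t).
Proof. by apply: (@abs_summable_le _ _ _ `|c|) => x; rewrite normrM. Qed.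

(** Tannery's theorem: outside a finite set [A] adapted to the majorant [g], the tails of all the
    [f n] and of [h] are uniformly small; on [A] finitely many pointwise limits suffice. *)
Lemma dominated_seq_cvg (I : choiceType) (f : nat -> I -> K) (h : I -> K) (g : I -> K)
    (s : nat -> K) S G :
  (forall x, seq_cvg (f ^~ x) (h x)) ->
  (forall n x, `|f n x| <= g x) -> (forall x, `|h x| <= g x) -> has_sum g G ->
  (forall n, has_sum (f n) (s n)) -> has_sum h S -> seq_cvg s S.
Proof.
move=> fh fg hg gG fs hS e e0.
have e8 : 0 < e / 8 by rewrite divr_gt0.
have [A hA] := gG _ e8.
(* Two eighths come from comparing two partial sums of [g] with [G], one from approximating [T]. The
   bound is used for [s n] and for [S], which leaves two eighths for the sum over [A]. *)
have tail k T : (forall x, `|k x| <= g x) -> has_sum k T ->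
    `|T - fsum k A| < e / 8 + e / 8 + e / 8.
  move=> kg kT; have [B hB] := kT _ e8.
  have AC := fsubsetUl A B; have BC := fsubsetUr A B.
  rewrite (_ : T - fsum k A =
    (fsum k (A `|` B) - fsum k A) - (fsum k (A `|` B) - T)); last by ring.
  rewrite (le_lt_trans (ler_normB _ _))// ltr_leD ?(ltW (hB _ BC))//.
  have D (l : I -> K) : fsum l (A `|` B) - fsum l A =
      fsum l [fset x in (A `|` B) | x \notin A].
    rewrite /fsum (big_fsetID _ (mem A))/=.
    rewrite (_ : [fset x in A `|` B | x \in A] = A) ?[_ + _ - _]addrAC ?subrr ?add0r//.
    by apply/fsetP => x; rewrite !inE/=; case: (x \in A); rewrite ?andbF.
  rewrite D (le_lt_trans (ler_norm_sum _ _ _))//.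
  apply: (@le_lt_trans _ _ (fsum g (A `|` B) - fsum g A)).
    by rewrite D; apply: ler_sum.
  rewrite -[X in X < _]ger0_norm; last first.
    by rewrite D; apply: sumr_ge0 => x _; apply: le_trans (hg x).
  rewrite (_ : _ - _ = (fsum g (A `|` B) - G) - (fsum g A - G)); last by ring.
  by rewrite (le_lt_trans (ler_normB _ _))// ltrD ?hA.
have [N hN] : exists N, forall n, (N <= n)%N -> `|fsum (f n) A - fsum h A| <= e / 8.
  have [N hN] : exists N : I -> nat, forall x n, (N x <= n)%N ->
      `|f n x - h x| < e / 8 / (#|` A|.+1)%:R.
    have d0 : 0 < e / 8 / (#|` A|.+1)%:R by rewrite divr_gt0.
    by exists (fun x => projT1 (cid (fh x _ d0))) => x n; case: cid => /= N; apply.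
  exists (\max_(x <- A) N x)%N => n Nn.
  rewrite /fsum -sumrB (le_trans (ler_norm_sum _ _ _))//.
  apply: (@le_trans _ _ (\sum_(i <- A) (e / 8 / (#|` A|.+1)%:R))).
    rewrite big_seq [leRHS]big_seq; apply: ler_sum => i iA.
    by apply/ltW/hN; apply: leq_trans Nn; exact: leq_bigmax_seq.
  rewrite big_const_seq count_predT iter_addr addr0 -[_ *+ #|` _|]mulr_natr -[leLHS]mulrA.
  rewrite ler_piMr ?(ltW e8)// mulrC ler_pdivrMr// mul1r ler_nat.
  exact: leqnSn.
exists N => n /hN hn.
rewrite (_ : s n - S = (s n - fsum (f n) A) + (fsum (f n) A - fsum h A) - (S - fsum h A)); last by ring.
rewrite (_ : e = (e / 8 + e / 8 + e / 8) + (e/8 + e/8) + (e / 8 + e / 8 + e / 8)); last by field.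
rewrite (le_lt_trans (ler_normB _ _))// ltrD//; last exact: tail.
rewrite (le_lt_trans (ler_normD _ _))// ltrD//; first exact: tail.
by rewrite (le_lt_trans hn)// ltrDl.
Qed.

End UnconditionalSumsTheory.

Section Limits.
Variable K : numFieldType.

Lemma has_sum3_has_sum (f : nat -> nat -> nat -> K) S :
  has_sum (fun t : nat * nat * nat => f t.1.1 t.1.2 t.2) S -> has_sum3 f S.
Proof.
move=> fS; rewrite /has_sum3; apply/(@cvgrPdist_lt K K^o _ totally (@totally_filter _)) => e e0.
have [A hA] := fS e e0; exists A => // B /hA.
by rewrite distrC /fsum/= /partial_sum big_seq_fsetE.
Qed.

Lemma seq_cvg_lim (s : nat -> K) S : seq_cvg s S -> limn s = S.
Proof.
move=> h; apply/cvg_lim; first exact: norm_hausdorff.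
apply/cvgrPdist_lt => e e0; have [N hN] := h e e0.
by exists N => // n /hN; rewrite distrC.
Qed.

End Limits.

(** * Absolute summability implies summability over the complex numbers *)

Section Existence.
Variable R : realType.
Local Notation C := (R[i]).

Lemma real_has_sum_nneg (I : choiceType) (g : I -> R) (M : R) :
  (forall x, 0 <= g x) -> (forall A : {fset I}, \sum_(i <- A) g i <= M) ->
  exists S, has_sum g S.
Proof.
move=> g0 gM; pose E : set R := [set y | exists A : {fset I}, y = fsum g A]%classic.
have Eub : has_ubound E by exists M => _ [A ->]; exact: gM.
have En0 : nonempty E by exists (fsum g fset0), fset0.
exists (sup E) => e e0.
have [_ [A ->] hA] := sup_adherent e0 (conj En0 Eub).
exists A => B AB.
have h1 : fsum g B <= sup E by apply: ub_le_sup => //; exists B.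
have h2 : fsum g A <= fsum g B by exact: ler_sum_fsubset.
rewrite ler0_norm ?subr_le0// opprB; lra.
Qed.

(** [g] is the difference of the nonnegative families [|g|] and [|g| - g], whose sums are suprema of
    partial sums. *)
Lemma real_abs_summable_has_sum (I : choiceType) (g : I -> R) :
  abs_summable g -> exists S, has_sum g S.
Proof.
move=> [M hM].
have [S hS] := real_has_sum_nneg (fun x => normr_ge0 (g x)) hM.
have [T hT] : exists T, has_sum (fun x => `|g x| - g x) T.
  apply: (@real_has_sum_nneg _ _ (M + M)) => [x|A]; first by rewrite subr_ge0 ler_norm.
  apply: le_trans (lerD (hM A) (hM A)); rewrite -big_split/=.
  by apply: ler_sum => i _; rewrite lerD2l ler_normr lexx orbT.
exists (S + -1 * T); apply: eq_has_sum (has_sumD hS (has_sumZ (-1) hT)) => x /=; ring.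
Qed.

Lemma has_sum_real_complex (I : choiceType) (g : I -> R) S :
  has_sum g S -> has_sum (fun x => (g x)%:C : C) S%:C.
Proof.
(* In the partial order of the complex numbers a positive [e] is real. *)
move=> gS e e0; have eR : e = (complex.Re e)%:C.
  by move: e0; case: e => a b; rewrite ltcE/= => /andP[/eqP -> _].
have e0' : 0 < complex.Re e by rewrite -ltcR -eR.
have [A hA] := gS _ e0'; exists A => B /hA hB.
rewrite /fsum -rmorph_sum -rmorphB/=.
by rewrite normc_def/= expr0n addr0 sqrtr_sqr eR ltcR; exact: hB.
Qed.

Lemma abs_summable_has_sum (I : choiceType) (f : I -> C) :
  abs_summable f -> exists S, has_sum f S.
Proof.
move=> [M hM].
have h (g : I -> R) : (forall x, (`|g x|)%:C <= `|f x|) -> exists S, has_sum g S.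
  move=> gf; apply: real_abs_summable_has_sum; exists (complex.Re M) => A.
  suff : (\sum_(i <- A) `|g i|)%:C <= M.
    by case: (M) => a b; rewrite lecE/= => /andP[].
  by apply: le_trans (hM A); rewrite rmorph_sum; apply: ler_sum => x _; exact: gf.
have [S hS] := h (fun x => complex.Re (f x)) (fun x => normc_ge_Re _).
have [T hT] : exists S, has_sum (fun x => complex.Im (f x)) S.
  apply: h => x; case: (f x) => a b; rewrite normc_def/= lecR.
  by rewrite -sqrtr_sqr ler_wsqrtr// lerDr sqr_ge0.
exists (S%:C + 'i%C * T%:C).
have := has_sumD (has_sum_real_complex hS) (has_sumZ 'i%C (has_sum_real_complex hT)).
by apply: eq_has_sum => x; rewrite -complexE.
Qed.

(** Absolute summability supplies some sum [T] of the double family; summing [T] by rows and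
    uniqueness give [T = S]. *)
Lemma has_sum_iterated (I J : choiceType) (f : I * J -> C) (g : I -> C) S :
  abs_summable f -> (forall i, has_sum (fun j => f (i, j)) (g i)) ->
  has_sum g S -> has_sum f S.
Proof.
move=> /abs_summable_has_sum[T fT] fg gS.
by rewrite (has_sum_unique gS (has_sum_pair fT fg)).
Qed.

Lemma has_sum_prod (I J : choiceType) (f : I -> C) (g : J -> C) S T :
  abs_summable f -> abs_summable g -> has_sum f S -> has_sum g T ->
  has_sum (fun t : I * J => f t.1 * g t.2) (S * T).
Proof.
move=> fa ga fS gT.
apply: (has_sum_iterated (g := fun i => f i * T)) (abs_summable_prod fa ga) _ _.
  by move=> i /=; exact: has_sumZ.
by rewrite mulrC; apply: eq_has_sum (has_sumZ T fS) => x; rewrite mulrC.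
Qed.

Lemma expr_norm_lt (r e : C) : 0 <= r < 1 -> 0 < e -> exists N, forall n, (N <= n)%N -> r ^+ n < e.
Proof.
case/andP => r0 r1 e0.
have rR (x : C) : 0 <= x -> x = (complex.Re x)%:C.
  by case: x => a b; rewrite lecE/= => /andP[/eqP -> _].
have {}r1 : complex.Re r < 1 by rewrite -ltcR -(rR _ r0).
have {}r0' : 0 <= complex.Re r by rewrite -lecR -(rR _ r0).
have {}e0' : 0 < complex.Re e by rewrite -ltcR -(rR _ (ltW e0)).
have /cvgrPdist_lt/(_ _ e0')[N _ hN] : (((complex.Re r) ^+ n) @[n --> \oo] --> 0)%classic.
  by apply: cvg_expr; rewrite ger0_norm.
exists N => n /hN/=; rewrite sub0r normrN ger0_norm ?exprn_ge0// => h.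
by rewrite (rR _ r0) (rR _ (ltW e0)) -rmorphXn ltcR.
Qed.

End Existence.

(** * Absolute summability by quadratic growth *)

Section Growth.
Variable R : realType.
Local Notation C := (R[i]).

(** Once r^N < (1 - r)/2, the product of any n factors following the first N stays above (1 +
    r^n)/2. This strengthening of the bound 1/2 is what makes the induction on n close. *)
Lemma prod_one_sub_ge (r : R) : 0 <= r < 1 ->
  exists2 c, 0 < c & forall n, c <= \prod_(k < n) (1 - r ^+ k.+1).
Proof.
case/andP => r0 r1; have e0 : 0 < (1 - r) / 2 by rewrite divr_gt0// subr_gt0.
have [N hN] : exists N, r ^+ N < (1 - r) / 2.
  have /cvgrPdist_lt/(_ _ e0)[N _ hN] : ((r ^+ n) @[n --> \oo] --> 0)%classic.
    by apply: cvg_expr; rewrite ger0_norm.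
  by exists N; have := hN N (leqnn N); rewrite sub0r normrN ger0_norm ?exprn_ge0.
pose P n := \prod_(k < n) (1 - r ^+ k.+1).
have f01 k : 0 < 1 - r ^+ k.+1 <= 1.
  by rewrite subr_gt0 exprn_ilt1//= gerBl exprn_ge0.
have P0 n : 0 < P n by apply: prodr_gt0 => k _; case/andP: (f01 k).
have tail n : (1 + r ^+ n) / 2 <= \prod_(k < n) (1 - r ^+ (N + k).+1).
  elim: n => [|n IH]; first by rewrite big_ord0 expr0 -mulr2n -mulr_natr mul1r divff.
  rewrite big_ord_recr/=; have /andP[h1 h2] := f01 (N + n)%N.
  apply: le_trans (ler_wpM2r (ltW h1) IH).
  have rn1 : r ^+ n <= 1 by rewrite exprn_ile1// ltW.
  have rn0 : 0 <= r ^+ n by rewrite exprn_ge0.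
  have h : r ^+ (N + n).+1 <= r ^+ n * ((1 - r) / 2).
    rewrite (_ : _ ^+ _ = r ^+ n * (r * r ^+ N)); last by rewrite exprS exprD; ring.
    rewrite ler_wpM2l// (le_trans _ (ltW hN))// ler_piMl ?exprn_ge0//; exact: ltW.
  have h0 : 0 <= r ^+ (N + n).+1 by rewrite exprn_ge0.
  rewrite exprS; nra.
exists (P N / 2) => [|n]; first by rewrite divr_gt0.
have : P (N + n)%N <= P n.
  rewrite addnC /P big_split_ord/= ler_piMr ?(ltW (P0 n))//.
  apply: prodr_ile1 => k _; have /andP[h1 h2] := f01 (n + k)%N; rewrite h2 andbT; exact: ltW.
apply: le_trans; rewrite /P big_split_ord/= ler_wpM2l ?(ltW (P0 N))//.
apply: le_trans (tail n); rewrite -[leLHS]mul1r ler_wpM2r// lerDl.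
exact: exprn_ge0.
Qed.


End Growth.

Section GeometricSummability.
Variable K : numFieldType.

Lemma abs_summable_geometric (r : K) : 0 <= r < 1 ->
  abs_summable (fun n : int => r ^+ `|n|%N).
Proof.
case/andP => r0 r1; have h : 0 < 1 - r by rewrite subr_gt0.
have G N : \sum_(k <- iota 0 N) r ^+ k <= (1 - r)^-1.
  rewrite -[leRHS]mul1r ler_pdivlMr// mulrC.
  rewrite (_ : iota 0 N = index_iota 0 N) ?big_mkord; last by rewrite /index_iota subn0.
  rewrite -opprB mulNr -subrX1 opprB gerBl; exact: exprn_ge0.
exists (2 * (1 - r)^-1) => A.
pose N := (\max_(n <- A) `|n|.+1)%N.
pose B : {fset int} := [fset Posz k | k in iota 0 N] `|` [fset - (Posz k) | k in iota 0 N].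
have AB : A `<=` B.
  apply/fsubsetP => n nA.
  have nN : (`|n| < N)%N by exact: (@leq_bigmax_seq _ _ predT (fun n : int => `|n|.+1)).
  have [n0|n0] := leP 0 n; rewrite inE; apply/orP; [left|right]; apply/imfsetP.
    by exists `|n|%N; rewrite /= ?mem_iota//; lia.
  by exists `|n|%N; rewrite /= ?mem_iota//; lia.
have e n : `|r ^+ n| = r ^+ n by rewrite ger0_norm// exprn_ge0.
under eq_bigr do rewrite e.
apply: le_trans (ler_sum_fsubset _ AB) _; first by move=> x; rewrite exprn_ge0.
have U (X Y : {fset int}) : \sum_(i <- X `|` Y) r ^+ `|i|%N <=
   \sum_(i <- X) r ^+ `|i|%N + \sum_(i <- Y) r ^+ `|i|%N.
  rewrite (big_fsetID _ (mem X))/=; apply: lerD; apply: ler_sum_fsubset.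
  - by move=> x; rewrite exprn_ge0.
  - by apply/fsubsetP => x; rewrite !inE/= => /andP[].
  - by move=> x; rewrite exprn_ge0.
  - by apply/fsubsetP => x; rewrite !inE/= => /andP[/orP[->//|]].
apply: le_trans (U _ _) _; rewrite mulrC mulr_natr mulr2n; apply: lerD.
  rewrite big_imfset/= => [|x y _ _ []//]; rewrite undup_id ?iota_uniq//; exact: G.
rewrite big_imfset/= => [|x y _ _]; last by lia.
rewrite undup_id ?iota_uniq//; under eq_bigr do rewrite abszN; exact: G.
Qed.

End GeometricSummability.

(* Zero at negative [n], so that every sum below can run over all integers and be
   reindexed by affine bijections. *)
Definition inv_qpoch (K : numFieldType) (q : K) (n : int) : K :=
  if n is Posz m then (qpoch q q m)^-1 else 0.

Section QBounded.
Variable R : realType.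
Local Notation C := (R[i]).
Variable q : C.
Hypotheses (q_lt1 : `|q| < 1) (q_neq0 : q != 0).
Local Notation u := (inv_qpoch q).

Lemma norm_exprz (x : C) (n : int) : `|x ^ n| = `|x| ^ n.
Proof. by case: n => n; rewrite ?NegzE -?exprnN ?normfV normrX. Qed.

Lemma ler_norm_exprz (m n : int) : m <= n -> `|q| ^ n <= `|q| ^ m.
Proof.
move=> mn; have -> : n = m + Posz `|n - m|%N by lia.
rewrite expfzDr ?normr_eq0// ler_piMr ?exprz_ge0//.
by apply: exprn_ile1 => //; exact: ltW.
Qed.

Lemma one_sub_exprn_neq0 n : 1 - q ^+ n.+1 != 0.
Proof.
rewrite subr_eq0; apply/eqP => h.
have := exprn_ilt1 n.+1 (normr_ge0 q) q_lt1.
by rewrite -normrX -h normr1 ltxx.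
Qed.

Lemma qpoch_qq_neq0 n : qpoch q q n != 0.
Proof.
rewrite /qpoch; apply/prodf_neq0 => k _; rewrite -exprS; exact: one_sub_exprn_neq0.
Qed.

Lemma inv_qpoch0 : u 0 = 1.
Proof. by rewrite /= /qpoch big_ord0 invr1. Qed.

Lemma inv_qpoch_lt0 n : n < 0 -> u n = 0.
Proof. by case: n. Qed.

(** It holds at every integer: at n = 0 the left factor vanishes, and so does u(-1). All recurrences
    below are therefore free of boundary terms. *)
Lemma inv_qpoch_rec n : (1 - q ^ n) * u n = u (n - 1).
Proof.
case: n => [[|n]|n].
- by rewrite expr0z subrr mul0r.
- rewrite (_ : Posz n.+1 - 1 = Posz n); last by lia.
  rewrite /= [in qpoch q q n.+1]/qpoch big_ord_recr/= -exprS invfM mulrC -mulrA.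
  by rewrite mulVf ?mulr1// one_sub_exprn_neq0.
- rewrite (_ : Negz n - 1 = Negz n.+1) ?mulr0//; lia.
Qed.

(** Since |1 - q^k| >= 1 - |q|^k, the real lower bound for the base |q| applies. *)
Lemma inv_qpoch_le : exists U, forall n, `|u n| <= U.
Proof.
have rR : `|q| = (complex.Re `|q|)%:C.
  by have := normr_ge0 q; case: `|q| => a b; rewrite lecE/= => /andP[/eqP -> _].
have [|c c0 hc] := @prod_one_sub_ge _ (complex.Re `|q|).
  by rewrite -lecR -ltcR -rR q_lt1 normr_ge0.
exists (c^-1)%:C => -[n|n]; last by rewrite normr0 lecR invr_ge0 ltW.
rewrite /= normfV fmorphV/= lef_pV2 ?posrE ?normr_gt0 ?qpoch_qq_neq0 ?ltcR//.
apply: le_trans (_ : (\prod_(k < n) (1 - (complex.Re `|q|) ^+ k.+1))%:C <= _).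
  by rewrite lecR.
rewrite rmorph_prod/= /qpoch normr_prod; apply: ler_prod => k _.
rewrite rmorphB rmorph1 rmorphXn/= -rR -exprS subr_ge0 exprn_ile1 ?(ltW q_lt1)//=.
by rewrite -normrX -[X in X - _](normr1 C) lerB_dist.
Qed.

(** Growth is recorded by an integer exponent alone, so that summability of a product of powers and
    Pochhammer symbols becomes an inequality between integers. *)
Definition qbounded (I : Type) (f : I -> C) (E : I -> int) :=
  exists2 M, 0 <= M & forall x, `|f x| <= M * `|q| ^ E x.

Lemma qbounded_exprz I (E : I -> int) : qbounded (fun x => q ^ E x) E.
Proof. by exists 1 => // x; rewrite mul1r norm_exprz. Qed.

Lemma qbounded_inv_qpoch I (h : I -> int) : qbounded (fun x => u (h x)) (fun=> 0).
Proof.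
have [U hU] := inv_qpoch_le; exists U => [|x]; first exact: le_trans (hU 0).
by rewrite expr0z mulr1.
Qed.

Lemma qboundedM I (f g : I -> C) E F :
  qbounded f E -> qbounded g F -> qbounded (fun x => f x * g x) (fun x => E x + F x).
Proof.
move=> [M M0 hM] [N N0 hN]; exists (M * N) => [|x]; first exact: mulr_ge0.
rewrite normrM expfzDr ?normr_eq0// mulrACA; exact: ler_pM.
Qed.

(** Some power |q|^(-B) exceeds both |z| and 1/|z|, so a power of an arbitrary nonzero z costs only
    a linear term in the exponent, whatever the sign of [h]. *)
Lemma qbounded_exprz_of (z : C) : z != 0 ->
  exists B : nat, forall I (h : I -> int),
    qbounded (fun x => z ^ h x) (fun x => - (B%:Z * `|h x|%N%:Z)).
Proof.
move=> z0; have n0 : 0 < `|z| by rewrite normr_gt0.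
have e0 : 0 < (`|z| + `|z|^-1)^-1 by rewrite invr_gt0 addr_gt0// invr_gt0.
have [|B hB] := expr_norm_lt _ e0 (r := `|q|); first by rewrite normr_ge0.
have {}hB : `|z| + `|z|^-1 <= `|q| ^ (- B%:Z).
  rewrite -exprnN -[leLHS]invrK lef_pV2 ?posrE ?exprn_gt0 ?normr_gt0//.
  exact/ltW/hB.
exists B => I h; exists 1 => // x; rewrite mul1r norm_exprz.
rewrite -mulNr -exprz_exp.
have [hx|hx] := leP 0 (h x).
  rewrite -[in leLHS](gez0_abs hx); apply: lerXn2r; rewrite ?nnegrE ?exprz_ge0//.
  by apply: le_trans hB; rewrite lerDl invr_ge0.
rewrite [in leLHS](_ : h x = - (`|h x|%N%:Z)); last by lia.
rewrite -exprnN -exprVn; apply: lerXn2r; rewrite ?nnegrE ?exprz_ge0 ?invr_ge0//.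
by apply: le_trans hB; rewrite lerDr.
Qed.

(** If E grows at least like the square of the size s, up to linear terms, then E >= s - c for a
    constant c, and the family is dominated by the summable |q|^s. *)
Lemma qbounded_summable (I : choiceType) (s : I -> nat) (f : I -> C) E (D A : nat) :
  abs_summable (fun x => `|q| ^+ s x) -> qbounded f E -> (0 < D)%N ->
  (forall x, (s x)%:Z ^+ 2 <= D%:Z * E x + A%:Z * (s x)%:Z + A%:Z) ->
  abs_summable f.
Proof.
move=> sq [M M0 hM] D0 hE.
(* From (s - (A + D))^2 >= 0 one gets (A + D) s <= s^2 + (A + D)^2, and the hypothesis turns this
   into D s <= D E + c. *)
pose c : nat := ((A + D) ^ 2 + A)%N.
apply: (abs_summable_le (c := M * `|q| ^ (- c%:Z))) sq => x.
apply: le_trans (hM x) _; rewrite -mulrA ler_wpM2l//.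
rewrite normrX normr_id -[_ ^+ s x]/(_ ^ (s x)%:Z) -expfzDr ?normr_eq0//.
apply: ler_norm_exprz.
have {}hE := hE x; set e := E x in hE *; set n := s x in hE *.
have h1 : D%:Z * n%:Z <= D%:Z * e + c%:Z.
  have := sqr_ge0 (n%:Z - (A + D)%N%:Z); rewrite /c; nia.
have h2 : D%:Z * (- c%:Z + n%:Z - e) <= 0 by nia.
have : - c%:Z + n%:Z - e <= 0 by rewrite -(pmulr_rle0 _ (_ : 0 < D%:Z)).
by rewrite subr_le0.
Qed.

Lemma abs_summable_size1 : abs_summable (fun n : int => `|q| ^+ `|n|%N).
Proof. by apply: abs_summable_geometric; rewrite normr_ge0. Qed.

Lemma abs_summable_size2 :
  abs_summable (fun t : int * int => `|q| ^+ (`|t.1|%N + `|t.2|%N)).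
Proof.
have := abs_summable_prod abs_summable_size1 abs_summable_size1.
by apply: (abs_summable_le (c := 1)) => x; rewrite mul1r exprD.
Qed.

Lemma abs_summable_size3 :
  abs_summable (fun t : int * int * int => `|q| ^+ (`|t.1.1|%N + `|t.1.2|%N + `|t.2|%N)).
Proof.
have := abs_summable_prod abs_summable_size2 abs_summable_size1.
by apply: (abs_summable_le (c := 1)) => x; rewrite mul1r !exprD.
Qed.

End QBounded.

(** * Euler, Durfee and Jacobi *)

Section SeqCvg.
Variable K : numFieldType.

Lemma seq_cvg_cst (c : K) : seq_cvg (fun=> c) c.
Proof. by move=> e e0; exists 0%N => n _; rewrite subrr normr0. Qed.

Lemma seq_cvg_sub (s : nat -> K) (h : nat -> nat) S :
  (forall n, (n <= h n)%N) -> seq_cvg s S -> seq_cvg (s \o h) S.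
Proof.
move=> hn sS e e0; have [N hN] := sS e e0; exists N => n Nn.
exact/hN/(leq_trans Nn).
Qed.

Lemma seq_cvgM (s t : nat -> K) S T :
  seq_cvg s S -> seq_cvg t T -> seq_cvg (fun n => s n * t n) (S * T).
Proof.
move=> sS tT e e0.
have d0 : 0 < 1 + `|S| + `|T| by rewrite -addrA ltr_wpDr ?addr_ge0.
have e1 : 0 < Num.min 1 (e / (1 + `|S| + `|T|)).
  by rewrite /Num.min; case: ifP => // _; rewrite divr_gt0.
have [M hM] := tT 1 ltr01.
have e2 : 0 < e / (1 + `|S| + `|T|) / 2 by rewrite !divr_gt0.
have [N hN] := sS _ e2; have [N' hN'] := tT _ e2.
exists (maxn M (maxn N N')) => n; rewrite !geq_max => /and3P[/hM a /hN b /hN' c].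
have tn : `|t n| <= 1 + `|T|.
  rewrite -[t n](subrK T) (le_trans (ler_normD _ _))// lerD2r; exact: ltW.
rewrite (_ : _ - _ = (s n - S) * t n + S * (t n - T)); last by ring.
rewrite (le_lt_trans (ler_normD _ _))// !normrM.
apply: (@le_lt_trans _ _ (e / (1 + `|S| + `|T|) / 2 * (1 + `|T|) +
    `|S| * (e / (1 + `|S| + `|T|) / 2))).
  by apply: lerD; apply: ler_pM => //; exact: ltW.
rewrite [_ / 2 * _]mulrC -mulrDl addrAC mulrC mulrAC divfK ?gt_eqF//.
by rewrite ltr_pdivrMr// ltr_pMr// ltr1n.
Qed.

Lemma seq_cvg_prod (I : Type) (r : seq I) (s : I -> nat -> K) (S : I -> K) :
  (forall i, seq_cvg (s i) (S i)) ->
  seq_cvg (fun n => \prod_(i <- r) s i n) (\prod_(i <- r) S i).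
Proof.
move=> h; elim: r => [|i r IH].
  rewrite big_nil; under [s in seq_cvg s]funext do rewrite big_nil; exact: seq_cvg_cst.
rewrite big_cons; under [s in seq_cvg s]funext do rewrite big_cons.
exact: seq_cvgM.
Qed.

Lemma has_sum_reindex (I J : choiceType) (h : I -> J) (h' : J -> I) (f : J -> K) S :
  cancel h h' -> cancel h' h -> has_sum f S -> has_sum (f \o h) S.
Proof.
move=> hK h'K fS; apply: (has_sum_bij h'K hK).
by apply: eq_has_sum fS => x /=; rewrite h'K.
Qed.

Lemma has_sum_shift (f : int -> K) a S :
  has_sum f S -> has_sum (fun n => f (n + a)) S.
Proof. exact: has_sum_reindex (addrK a) (subrK a). Qed.

Lemma has_sum_opp (f : int -> K) S : has_sum f S -> has_sum (fun n => f (- n)) S.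
Proof. exact: has_sum_reindex (@opprK _) (@opprK _). Qed.

End SeqCvg.

Definition tri (n : int) : int := ((n * (n - 1)) %/ 2)%Z.

Lemma double_tri n : 2 * tri n = n * (n - 1).
Proof.
rewrite /tri mulrC divzK//.
have [k [->|->]] : exists k, n = 2 * k \/ n = 2 * k + 1.
  by exists (n %/ 2)%Z; lia.
- by rewrite -mulrA dvdz_mulr.
- by rewrite addrK mulrCA dvdz_mulr.
Qed.

(** Each [tri x] becomes a variable t known only through 2 t = x (x - 1), which reduces identities
    between exponents to integer arithmetic. *)
Ltac tri_gen := repeat match goal with |- context [tri ?x] =>
  move: (double_tri x); move: (tri x) => ? end.
Ltac tri_lia := rewrite ?expr2; tri_gen; lia.

Section Euler.
Variable R : realType.
Local Notation C := (R[i]).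
Variable q : C.
Hypotheses (q_lt1 : `|q| < 1) (q_neq0 : q != 0).
Local Notation u := (inv_qpoch q).

Lemma abs_summable_euler z : z != 0 ->
  abs_summable (fun k : int => q ^ tri k * z ^ k * u k).
Proof.
move=> z0; have [B hB] := qbounded_exprz_of q_lt1 q_neq0 z0.
apply: (qbounded_summable q_lt1 q_neq0 (D := 2) (A := 2 * B + 1)
  (abs_summable_size1 q_lt1)
  (qboundedM q_neq0 (qboundedM q_neq0 (qbounded_exprz q tri) (hB _ id))
    (qbounded_inv_qpoch q_lt1 id))) => // k.
rewrite addr0; tri_lia.
Qed.

(** The functional equation F(z) = (1 + z) F(zq) of Euler's series, coming from q^k u(k) + u(k - 1)
    = u(k) and tri(k) = tri(k - 1) + k - 1. *)
Lemma has_sum_euler_step z S T : z != 0 ->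
  has_sum (fun k : int => q ^ tri k * z ^ k * u k) S ->
  has_sum (fun k : int => q ^ tri k * (z * q) ^ k * u k) T ->
  S = (1 + z) * T.
Proof.
move=> z0 hS hT; rewrite mulrDl mul1r.
apply: (has_sum_unique hS).
apply: eq_has_sum (has_sumD hT (has_sumZ z (has_sum_shift (-1) hT))) => k /=.
rewrite -[k + -1]/(k - 1) -inv_qpoch_rec// !expfzMl.
rewrite (_ : tri k = tri (k - 1) + (k - 1)); last by tri_lia.
rewrite (_ : z ^ k = z * z ^ (k - 1)); last first.
  by rewrite -[X in X * _]expr1z -expfzDr//; congr (_ ^ _); ring.
rewrite (_ : q ^ k = q * q ^ (k - 1)); last first.
  by rewrite -[X in X * _]expr1z -expfzDr//; congr (_ ^ _); ring.
rewrite [q ^ (_ + (k - 1))]expfzDr//. ring.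
Qed.

Lemma has_sum_euler_iter z n S T : z != 0 ->
  has_sum (fun k : int => q ^ tri k * z ^ k * u k) S ->
  has_sum (fun k : int => q ^ tri k * (z * q ^+ n) ^ k * u k) T ->
  S = qpoch (- z) q n * T.
Proof.
move=> z0; elim: n T => [|n IH] T hS hT.
  rewrite /qpoch big_ord0 mul1r; apply: (has_sum_unique hS).
  by apply: eq_has_sum hT => k; rewrite expr0 mulr1.
have zn0 : z * q ^+ n != 0 by rewrite mulf_neq0// expf_neq0.
have [V hV] := abs_summable_has_sum (abs_summable_euler zn0).
rewrite (IH _ hS hV) /qpoch big_ord_recr/= -mulrA; congr (_ * _).
rewrite mulNr opprK; apply: has_sum_euler_step hV _ => //.
by apply: eq_has_sum hT => k; rewrite exprSr mulrA.
Qed.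

Lemma abs_summable_norm (I : choiceType) (f : I -> C) :
  abs_summable f -> exists S, has_sum (fun x => `|f x|) S.
Proof.
move=> fa; apply: abs_summable_has_sum.
by apply: (abs_summable_le (c := 1)) fa => x; rewrite normr_id mul1r.
Qed.

(** F(z q^n) tends to 1: the series at n = 0 is a majorant, and only the term k = 0 survives in the
    limit. *)
Lemma euler_tail z (s : nat -> C) : z != 0 ->
  (forall n, has_sum (fun k : int => q ^ tri k * (z * q ^+ n) ^ k * u k) (s n)) ->
  seq_cvg s 1.
Proof.
move=> z0 hs.
have [G hG] := abs_summable_norm (abs_summable_euler z0).
have hE : has_sum (fun k : int => (k == 0)%:R : C) 1.
  by apply: (@has_sum_single _ _ (fun k : int => (k == 0)%:R : C) 0) => k /negPf ->.
have nz : 0 <= `|q| < 1 by rewrite normr_ge0.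
apply: (dominated_seq_cvg _ _ _ hG hs hE).
- move=> [[|k]|k].
  + rewrite eqxx; under [s in seq_cvg s]funext do
      rewrite [tri 0](_ : _ = 0)// !expr0z mulr1 mul1r inv_qpoch0; exact: seq_cvg_cst.
  + move=> e e0; set c := q ^ tri k.+1 * z ^ k.+1 * u k.+1.
    have c0 : 0 < 1 + `|c| by rewrite ltr_wpDr.
    have [N hN] := expr_norm_lt nz (divr_gt0 e0 c0).
    exists N => n Nn; rewrite subr0 expfzMl.
    rewrite (_ : _ * _ = c * (q ^+ n) ^ k.+1); last by rewrite /c; ring.
    rewrite normrM -exprnP !normrX.
    apply: (@le_lt_trans _ _ (`|c| * `|q| ^+ n)).
      rewrite ler_wpM2l// exprS ler_piMr ?exprn_ge0//.
      by rewrite -exprM exprn_ile1// ltW.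
    apply: (@le_lt_trans _ _ ((1 + `|c|) * `|q| ^+ n)).
      by rewrite ler_wpM2r ?exprn_ge0// lerDr.
    by rewrite mulrC -ltr_pdivlMr// hN.
  + under [s in seq_cvg s]funext do rewrite mulr0; exact: seq_cvg_cst.
- move=> n [k|k]; last by rewrite !mulr0.
  rewrite expfzMl (_ : _ * _ = q ^ tri k * z ^ k * u k * (q ^+ n) ^ k); last by ring.
  by rewrite normrM ler_piMr// -exprnP !normrX -exprM exprn_ile1// ltW.
- move=> [[|k]|k] //=; rewrite ?normr0//.
  by rewrite -[q ^ _]/(q ^ 0) !expr0z /qpoch big_ord0 invr1 !mulr1 normr1.
Qed.

(** Convergence of the infinite product is a consequence, not an input: S = (-z; q)_n F(z q^n) with
    F(z q^n) tending to 1 forces the partial products to tend to S. *)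
Lemma has_sum_euler_cvg z S : z != 0 ->
  has_sum (fun k : int => q ^ tri k * z ^ k * u k) S -> seq_cvg (qpoch (- z) q) S.
Proof.
move=> z0 hS.
have [s hs] : exists s : nat -> C, forall n,
    has_sum (fun k : int => q ^ tri k * (z * q ^+ n) ^ k * u k) (s n).
  have h n : exists T, has_sum (fun k : int => q ^ tri k * (z * q ^+ n) ^ k * u k) T.
    by apply/abs_summable_has_sum/abs_summable_euler; rewrite mulf_neq0// expf_neq0.
  by exists (fun n => projT1 (cid (h n))) => n; case: cid.
have s1 := euler_tail z0 hs.
have E n : S = qpoch (- z) q n * s n by exact: has_sum_euler_iter hS (hs n).
move=> e e0.
(* Closeness 1/2 to the limit 1 keeps |s n| above 1/2, so that division by [s n] is controlled. *)
have h2 : 0 < 2^-1 :> C by rewrite invr_gt0.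
have d0 : 0 < 1 + `|S| by rewrite ltr_wpDr.
have e2 : 0 < e / (1 + `|S|) / 2 by rewrite !divr_gt0.
have [N hN] := s1 _ h2; have [M hM] := s1 _ e2.
exists (maxn N M) => n; rewrite geq_max => /andP[/hN a /hM b].
have sn : 2^-1 <= `|s n|.
  have h : 1 <= `|s n| + 2^-1.
    have := ler_normB (s n) (s n - 1); rewrite opprB addrC subrK normr1 => h.
    by apply: le_trans h _; rewrite lerD2l ltW.
  rewrite -(lerD2r 2^-1) (le_trans _ h)// -mulr2n -[_ *+ 2]mulr_natr mulVf//.
have sn0 : 0 < `|s n| by apply: lt_le_trans sn.
rewrite (_ : _ - S = S * (1 - s n) / s n); last first.
  by rewrite [in RHS](E n) [in X in _ - X](E n); field; rewrite -normr_gt0.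
rewrite normrM normfV ltr_pdivrMr// normrM distrC.
apply: (@le_lt_trans _ _ (`|S| * (e / (1 + `|S|) / 2))).
  by rewrite ler_wpM2l// ltW.
apply: (@lt_le_trans _ _ (e / 2)); last by rewrite ler_wpM2l// ltW.
rewrite (_ : _ * _ = `|S| / (1 + `|S|) * (e / 2)); last by field; rewrite gt_eqF.
by rewrite gtr_pMl ?divr_gt0// ltr_pdivrMr// mul1r ltrDr.
Qed.

Lemma has_sum_euler z : z != 0 ->
  has_sum (fun k : int => q ^ tri k * z ^ k * u k) (qpoch_inf (- z) q).
Proof.
move=> z0; have [S hS] := abs_summable_has_sum (abs_summable_euler z0).
by have := seq_cvg_lim (has_sum_euler_cvg z0 hS); rewrite /qpoch_inf => ->.
Qed.

Lemma qpoch_cvg a : a != 0 -> seq_cvg (qpoch a q) (qpoch_inf a q).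
Proof.
move=> a0; have na0 : - a != 0 by rewrite oppr_eq0.
by have := has_sum_euler_cvg na0 (has_sum_euler na0); rewrite opprK.
Qed.

(** The inverses of the partial products are bounded by [U], so the products stay at distance at
    least 1/U from 0. *)
Lemma qpoch_inf_neq0 : qpoch_inf q q != 0.
Proof.
have [U hU] := inv_qpoch_le q_lt1.
apply/eqP => h; have := qpoch_cvg q_neq0; rewrite h => c.
have U0 : 0 < U by apply: lt_le_trans (hU 0); rewrite inv_qpoch0 normr1.
have e0 : 0 < U^-1 by rewrite invr_gt0.
have [N /(_ N (leqnn N))] := c _ e0; rewrite subr0.
have := hU N; rewrite /= normfV -[X in _ <= X]invrK lef_pV2 ?posrE//; last first.
  by rewrite normr_gt0 qpoch_qq_neq0.
by move=> a b; have := lt_le_trans b a; rewrite ltxx.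
Qed.

Lemma inv_qpoch_cvg : seq_cvg (fun n : nat => u n) (qpoch_inf q q)^-1.
Proof.
have [U hU] := inv_qpoch_le q_lt1.
have U0 : 0 < U by apply: lt_le_trans (hU 0); rewrite inv_qpoch0 normr1.
have P0 := qpoch_inf_neq0; have P0' : 0 < `|qpoch_inf q q| by rewrite normr_gt0.
move=> e e0.
have d0 : 0 < e * `|qpoch_inf q q| / U by rewrite !(divr_gt0, mulr_gt0).
have [N hN] := qpoch_cvg q_neq0 d0; exists N => n /hN h.
have Pn := qpoch_qq_neq0 q_lt1 n.
rewrite (_ : _ - _ = (qpoch_inf q q - qpoch q q n) * u n / qpoch_inf q q); last first.
  by rewrite /=; field; rewrite Pn P0.
rewrite normrM (normfV (qpoch_inf q q)) normrM ltr_pdivrMr// distrC.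
apply: (@le_lt_trans _ _ (`|qpoch q q n - qpoch_inf q q| * U)).
  by rewrite ler_wpM2l.
by rewrite -ltr_pdivlMr.
Qed.

End Euler.

Section TripleProduct.
Variable R : realType.
Local Notation C := (R[i]).
Variable q : C.
Hypotheses (q_lt1 : `|q| < 1) (q_neq0 : q != 0).
Local Notation u := (inv_qpoch q).
Local Notation qD := (fun m n => @expfzDr _ q m n q_neq0).

Lemma inv_qpoch_pred n : u (n - 1) = (1 - q ^ n) * u n.
Proof. by rewrite inv_qpoch_rec. Qed.

(** Each factor [u] matters only through its boundedness, so [e] and [f] are arbitrary; the constant
    argument 0 makes a factor disappear. *)
Lemma abs_summable_durfee (d a : int) (e f : int -> int) :
  abs_summable (fun m : int => q ^ (m * (m + d)) * u (m + a) * u (e m) * u (f m)).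
Proof.
apply: (qbounded_summable q_lt1 q_neq0 (D := 1) (A := `|d|)
  (abs_summable_size1 q_lt1)
  (qboundedM q_neq0 (qboundedM q_neq0 (qboundedM q_neq0
    (qbounded_exprz q (fun m => m * (m + d)))
    (qbounded_inv_qpoch q_lt1 (fun m => m + a)))
    (qbounded_inv_qpoch q_lt1 e)) (qbounded_inv_qpoch q_lt1 f))) => // k.
rewrite !addr0 mul1r expr2; nia.
Qed.

(** A limiting case of the q-Chu-Vandermonde sum, by induction on N for all d at once. Multiplying
    the sum [V] for (N + 1, d) by 1 - q^(N+1) gives the sum for (N, d + 1), up to the difference of
    the family of [W] and its shift by 1, which sums to 0. *)
Lemma durfee_finite (N : nat) (d : int) :
  has_sum (fun m : int => q ^ (m * (m + d)) * u m * u (N%:Z - m) * u (m + d))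
    (u N * u (N%:Z + d)).
Proof.
elim: N d => [|N IH] d.
  rewrite (_ : _ * _ =
    (fun m : int => q ^ (m * (m + d)) * u m * u (0%:Z - m) * u (m + d)) 0); last first.
    by rewrite mul0r expr0z subr0 !inv_qpoch0 !mul1r.
  apply: has_sum_single => m m0; have [|] := ltP m 0 => hm.
    by rewrite (inv_qpoch_lt0 _ hm) mulr0 !mul0r.
  by rewrite (@inv_qpoch_lt0 _ _ (0%:Z - m)) ?mulr0 ?mul0r//; lia.
have [V hV] := abs_summable_has_sum
  (abs_summable_durfee d 0 (fun m => N.+1%:Z - m) (fun m => m + d)).
have [W hW] := abs_summable_has_sum
  (abs_summable_durfee d (-1) (fun m => N.+1%:Z - m) (fun m => m + d)).
have h : (1 - q ^ N.+1%:Z) * V = u N * u (N%:Z + (d + 1)).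
  apply: has_sum_unique (IH _).
  have := has_sumD (has_sum_shift 1 hW) (has_sumD (has_sumZ (1 - q ^ N.+1%:Z) hV) (has_sumZ (-1) hW)).
  rewrite (_ : W + _ = (1 - q ^ N.+1%:Z) * V); last by ring.
  apply: eq_has_sum => m /=.
  rewrite !addr0.
  rewrite (_ : m + 1 - 1 = m) ?addrK//.
  rewrite (_ : N.+1%:Z - (m + 1) = N%:Z - m); last by lia.
  rewrite (_ : m + (d + 1) = m + 1 + d); last by ring.
  rewrite !inv_qpoch_pred.
  rewrite (_ : N%:Z - m = N.+1%:Z - m - 1); last by lia.
  rewrite !inv_qpoch_pred.
  rewrite (_ : m + d = m + 1 + d - 1); last by ring.
  rewrite !inv_qpoch_pred.
  rewrite (_ : (m + 1) * (m + 1 + d) = m * (m + 1 + d - 1) + m + (m + 1 + d)); last by ring.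
  rewrite (_ : m * (m + 1 + d) = m * (m + 1 + d - 1) + m); last by ring.
  rewrite (_ : N.+1%:Z = m + (N.+1%:Z - m)); last by ring.
  rewrite (_ : m + (N.+1%:Z - m) - m = N.+1%:Z - m); last by ring.
  rewrite !qD.
  ring.
suff -> : u N.+1 * u (N.+1%:Z + d) = V.
  by apply: eq_has_sum hV => m; rewrite addr0.
have n0 : 1 - q ^ N.+1%:Z != 0 by exact: one_sub_exprn_neq0.
apply: (mulfI n0); rewrite h mulrA inv_qpoch_rec //.
by congr (u _ * u _); lia.

Qed.

Lemma inv_qpoch_shift_cvg (a : int) :
  seq_cvg (fun n : nat => u (n%:Z + a)) (qpoch_inf q q)^-1.
Proof.
move=> e /(inv_qpoch_cvg q_lt1 q_neq0)[N hN]; exists (N + `|a|)%N => n Nn.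
rewrite (_ : n%:Z + a = `|(n%:Z + a)%R|%N); last by lia.
by apply: hN; lia.
Qed.

(** As N grows, u(N - m), u(N) and u(N + d) all tend to 1/(q)_oo in the finite form; one factor
    1/(q)_oo then cancels from both sides. *)
Lemma durfee (d : int) :
  has_sum (fun m : int => q ^ (m * (m + d)) * u m * u (m + d)) (qpoch_inf q q)^-1.
Proof.
have P0 := qpoch_inf_neq0 q_lt1 q_neq0.
have fa := abs_summable_durfee d 0 (fun m => 0) (fun m => m + d).
have [S hS] := abs_summable_has_sum fa.
have {}hS : has_sum (fun m : int => q ^ (m * (m + d)) * u m * u (m + d)) S.
  by apply: eq_has_sum hS => m; rewrite addr0 inv_qpoch0 mulr1.
have [U hU] := inv_qpoch_le q_lt1.
have [G hG] := abs_summable_norm fa.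
have U0 : 0 <= U by apply: le_trans (hU 0).
suff : S * (qpoch_inf q q)^-1 = (qpoch_inf q q)^-1 * (qpoch_inf q q)^-1.
  by move/(mulIf (invr_neq0 P0)) => <-.
have hs := seq_cvgM (inv_qpoch_shift_cvg 0) (inv_qpoch_shift_cvg d).
apply: seq_cvg_unique hs.
(* The constant dominates both u(N - m) and its limit. *)
have hg := has_sumZ (U + `|(qpoch_inf q q)^-1|) hG.
rewrite mulrC.
apply: (dominated_seq_cvg
  (f := fun (n : nat) (m : int) => q ^ (m * (m + d)) * u m * u (n%:Z - m) * u (m + d))
  _ _ _ hg _ (has_sumZ (qpoch_inf q q)^-1 hS)).
- move=> m; set c := q ^ (m * (m + d)) * u m * u (m + d); rewrite [_ * c]mulrC.
  have := seq_cvgM (seq_cvg_cst c) (inv_qpoch_shift_cvg (- m)).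
  by congr seq_cvg; apply/funext => n; rewrite /c; ring.
- move=> n m; rewrite addr0 inv_qpoch0 mulr1 mulrAC normrM mulrC ler_wpM2r//.
  by rewrite (le_trans (hU _))// lerDl.
- move=> m; rewrite addr0 inv_qpoch0 mulr1 normrM ler_wpM2r//.
  by rewrite lerDr.
- by move=> n; rewrite addr0; exact: durfee_finite.
Qed.

Lemma abs_summable_theta z : z != 0 -> abs_summable (fun d : int => q ^ tri d * z ^ d).
Proof.
move=> z0; have [B hB] := qbounded_exprz_of q_lt1 q_neq0 z0.
apply: (qbounded_summable q_lt1 q_neq0 (D := 2) (A := 2 * B + 1)
  (abs_summable_size1 q_lt1)
  (qboundedM q_neq0 (qbounded_exprz q tri) (hB _ id))) => // k.
tri_lia.
Qed.

(* Multiply the Euler series of the first two factors; on the diagonals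
   i - m = d the sum over m is a Durfee sum. *)
Theorem jacobi_triple z : z != 0 ->
  has_sum (fun d : int => q ^ tri d * z ^ d)
    (qpoch_inf (- z) q * qpoch_inf (- (q / z)) q * qpoch_inf q q).
Proof.
move=> z0; have P0 := qpoch_inf_neq0 q_lt1 q_neq0.
have qz0 : q / z != 0 by rewrite mulf_neq0// invr_eq0.
have := has_sum_prod (abs_summable_euler q_lt1 q_neq0 z0)
  (abs_summable_euler q_lt1 q_neq0 qz0)
  (has_sum_euler q_lt1 q_neq0 z0) (has_sum_euler q_lt1 q_neq0 qz0).
move/(has_sum_reindex (h := fun t : int * int => (t.2 + t.1, t.2))
  (h' := fun t : int * int => (t.1 - t.2, t.2)) _ _) => h.
have {}h := h _ _.
have {h} := has_sum_pair (g := fun d => q ^ tri d * z ^ d * (qpoch_inf q q)^-1)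
  (h _ _) _.
move=> h; have {}h := has_sumZ (qpoch_inf q q) (h _ _ _).
rewrite mulrC; apply: eq_has_sum (h _ _ _).
- by move=> d; rewrite mulrC divfK.
- by move=> -[i m] /=; congr (_, _); ring.
- by move=> -[i m] /=; congr (_, _); ring.
move=> d; have := has_sumZ (q ^ tri d * z ^ d) (durfee d).
apply: eq_has_sum => m /=.
rewrite expfzMl exprz_inv -!invr_expz [z ^ (m + d)]expfzDr//.
rewrite (_ : tri (m + d) = tri d + (m * (m + d)) - tri m - m ); last by tri_lia.
rewrite !qD -!invr_expz.
have h1 := expfz_neq0 (tri m) q_neq0; have h2 := expfz_neq0 m q_neq0.
have h3 := expfz_neq0 m z0.
by field; rewrite h1 h2 h3.
Qed.

End TripleProduct.

(** * The triple sum *)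

Section TripleSum.
Variable R : realType.
Local Notation C := (R[i]).

(** The parametrisations of the two parity classes are left free, so that the shift of the first
    index that completes the square can be built into them. *)
Lemma has_sum_parity (I : choiceType) (f : int * int -> C) (he ho : I -> int * int) S T :
  injective he -> injective ho ->
  (forall x, exists n, (he x).2 = 2 * n) -> (forall x, exists n, (ho x).2 = 2 * n + 1) ->
  (forall d n, exists x, he x = (d, 2 * n)) ->
  (forall d n, exists x, ho x = (d, 2 * n + 1)) ->
  has_sum (f \o he) S -> has_sum (f \o ho) T -> has_sum f (S + T).
Proof.
move=> hei hoi he2 ho2 hes hos hS hT.
pose ev (n : int) := n == 2 * (n %/ 2)%Z.
have evE n : ev (2 * n) by rewrite /ev; lia.
have evO n : ev (2 * n + 1) = false by rewrite /ev; lia.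
have h1 : has_sum (fun t => if ev t.2 then f t else 0) S.
  apply: (iffRL (has_sum_inj _ hei _)) => [[d l] h|] /=.
    case: ifP => //; rewrite /ev => /eqP El.
    by have [x hx] := hes d (l %/ 2)%Z; case: (h x); rewrite hx -El.
  by apply: eq_has_sum hS => x /=; have [n ->] := he2 x; rewrite evE.
have h2 : has_sum (fun t => if ev t.2 then 0 else f t) T.
  apply: (iffRL (has_sum_inj _ hoi _)) => [[d l] h|] /=.
    case: ifP => // /negbT; rewrite /ev => El.
    have [x hx] := hos d (l %/ 2)%Z; case: (h x); rewrite hx; congr (_, _); lia.
  by apply: eq_has_sum hT => x /=; have [n ->] := ho2 x; rewrite evO.
by apply: eq_has_sum (has_sumD h1 h2) => x; case: ifP; rewrite ?addr0 ?add0r.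
Qed.

Variable q y : C.
Hypotheses (q_lt1 : `|q| < 1) (q_neq0 : q != 0) (y_neq0 : y != 0).
Local Notation u := (inv_qpoch q).
Local Notation qD := (fun m n => @expfzDr _ q m n q_neq0).

Lemma qpoch_infS a : a != 0 -> qpoch_inf a q = (1 - a) * qpoch_inf (a * q) q.
Proof.
move=> a0; have na0 : - a != 0 by rewrite oppr_eq0.
have naq0 : - a * q != 0 by rewrite mulf_neq0.
have := has_sum_euler_step q_lt1 q_neq0 na0 (has_sum_euler q_lt1 q_neq0 na0)
  (has_sum_euler q_lt1 q_neq0 naq0).
by rewrite mulNr !opprK.
Qed.

(** (-y q^(-j))_oo is (-y)_oo times the product of 1 + y q^(-i) for 1 <= i <= j. The coefficient of
    y^(j-m) in that product has lowest exponent -((m + 1) + ... + j) = tri(m + 1) - tri(j + 1). Each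
    induction step splits off one factor; for negative j both sides vanish. *)
Lemma has_sum_qbinomial (j : int) :
  has_sum (fun m : int => qpoch_inf (- y) q *
      (q ^ (tri (m + 1) - tri (j + 1)) * y ^ (j - m) * u m * u (j - m)))
    (u j * qpoch_inf (- (y * q ^ (- j))) q).
Proof.
case: j => [|j]; last first.
  rewrite mul0r; apply: has_sum0 => m; have [m0|m0] := ltP m 0.
    by rewrite (inv_qpoch_lt0 _ m0) mulr0 mul0r mulr0.
  by rewrite (@inv_qpoch_lt0 _ _ (_ - m)) ?mulr0//; lia.
elim=> [|j IH].
  set f := fun m : int => _; rewrite (_ : _ * _ = f 0).
    apply: has_sum_single => m m0; rewrite /f; have [hm|hm] := ltP m 0.
      by rewrite (inv_qpoch_lt0 _ hm) mulr0 mul0r mulr0.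
    by rewrite (@inv_qpoch_lt0 _ _ (_ - m)) ?mulr0//; lia.
  by rewrite /f oppr0 !subrr !expr0z !inv_qpoch0 !mulr1 mul1r.
have n0 : 1 - q ^ j.+1%:Z != 0 by exact: one_sub_exprn_neq0.
have c0 : y * q ^ (- j.+1%:Z) != 0 by rewrite mulf_neq0// expfz_neq0.
rewrite (@qpoch_infS (- (y * q ^ (- j.+1%:Z)))) ?oppr_eq0// opprK.
rewrite (_ : - _ * q = - (y * q ^ (- j%:Z))); last first.
  rewrite (_ : - j%:Z = - j.+1%:Z + 1); last by lia.
  by rewrite qD expr1z; ring.
have uj : u j = (1 - q ^ j.+1%:Z) * u j.+1 by rewrite inv_qpoch_rec//; congr u; lia.
have := has_sumZ (1 - q ^ j.+1%:Z)^-1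
  (has_sumD (has_sumZ (y * q ^ (- j.+1%:Z)) IH) (has_sum_shift (-1) IH)).
rewrite uj; set X := qpoch_inf (- (y * q ^ (- j%:Z))) q.
rewrite (_ : (1 - q ^ j.+1%:Z)^-1 * _ = u j.+1 * ((1 + y * q ^ (- j.+1%:Z)) * X)); last first.
  by field.
apply: eq_has_sum => m /=; apply: (mulfI n0); rewrite mulVKf//.
set P := qpoch_inf _ _.
rewrite (_ : m - 1 + 1 = m); last by ring.
rewrite (_ : j%:Z - (m - 1) = j.+1%:Z - m); last by lia.
rewrite -(inv_qpoch_rec q_lt1 q_neq0 m).
rewrite (_ : j%:Z - m = j.+1%:Z - m - 1); last by lia.
rewrite -(inv_qpoch_rec q_lt1 q_neq0 (_ - m)).
rewrite (_ : tri (j.+1%:Z + 1) = tri (j%:Z + 1) + j.+1%:Z); last by tri_lia.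
rewrite (_ : tri (m + 1) = tri m + m); last by tri_lia.
rewrite (_ : q ^ j.+1%:Z = q ^ m * q ^ (j.+1%:Z - m)); last first.
  by rewrite -qD; congr (_ ^ _); ring.
rewrite (_ : y ^ (j.+1%:Z - m) = y * y ^ (j.+1%:Z - m - 1)); last first.
  by rewrite -[X in X * _]expr1z -expfzDr//; congr (_ ^ _); ring.
rewrite (_ : tri m + m - tri (j%:Z + 1) = tri m - tri (j%:Z + 1) + m); last by ring.
rewrite (_ : tri m + m - (tri (j%:Z + 1) + j.+1%:Z) =
  tri m - tri (j%:Z + 1) - (j.+1%:Z - m)); last by ring.
rewrite (_ : - j.+1%:Z = - m - (j.+1%:Z - m)); last by ring.
move: (j.+1%:Z - m) => n; rewrite !qD -!invr_expz.
have h1 := expfz_neq0 m q_neq0; have h2 := expfz_neq0 n q_neq0.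
have h3 := expfz_neq0 (tri (j%:Z + 1)) q_neq0.
by field; rewrite h1 h2 h3.
Qed.

Variable w : C.
Hypothesis w_neq0 : w != 0.

Definition triple_term (i j k : int) : C :=
  q ^ (i * i + j * j + tri k - i * j - j * k) * y ^ k * w ^ (i - j) * u i * u j * u k.

Lemma abs_summable_triple :
  abs_summable (fun t : int * int * int => triple_term t.1.1 t.1.2 t.2).
Proof.
have [B hB] := qbounded_exprz_of q_lt1 q_neq0 y_neq0.
have [D hD] := qbounded_exprz_of q_lt1 q_neq0 w_neq0.
apply: (qbounded_summable q_lt1 q_neq0 (D := 28) (A := 28 * (B + D) + 14)
  (abs_summable_size3 q_lt1)
  (qboundedM q_neq0 (qboundedM q_neq0 (qboundedM q_neq0 (qboundedM q_neq0 (qboundedM q_neq0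
    (qbounded_exprz q (fun t : int * int * int =>
      t.1.1 * t.1.1 + t.1.2 * t.1.2 + tri t.2 - t.1.1 * t.1.2 - t.1.2 * t.2))
    (hB _ (fun t => t.2))) (hD _ (fun t => t.1.1 - t.1.2)))
    (qbounded_inv_qpoch q_lt1 (fun t => t.1.1)))
    (qbounded_inv_qpoch q_lt1 (fun t => t.1.2)))
    (qbounded_inv_qpoch q_lt1 (fun t => t.2)))) => // -[[i j] k] /=.
rewrite !addr0 !PoszD.
(* Twice the exponent of q is a^2 + b^2 + c^2 - k. As |i| + |j| + |k| <= 3|a| + 2|b| + |c|,
   Cauchy-Schwarz gives the constant 14 = 9 + 4 + 1; the three squares below are the defect in
   Lagrange's identity. *)
set a := i; set b := j - i; set c := k - j.
have h : (`|i|%N%:Z + `|j|%N%:Z + `|k|%N%:Z) ^+ 2 <= 14 * (a * a + b * b + c * c).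
  apply: (@le_trans _ _ ((3 * `|a|%N%:Z + 2 * `|b|%N%:Z + `|c|%N%:Z) ^+ 2)).
    by apply: lerXn2r; rewrite ?nnegrE; lia.
  have := sqr_ge0 (2 * `|a|%N%:Z - 3 * `|b|%N%:Z).
  have := sqr_ge0 (`|a|%N%:Z - 3 * `|c|%N%:Z).
  have := sqr_ge0 (`|b|%N%:Z - 2 * `|c|%N%:Z).
  have abs x : x * x = `|x|%N%:Z * `|x|%N%:Z by nia.
  rewrite (abs a) (abs b) (abs c) !expr2; move: (`|a|%N%:Z) (`|b|%N%:Z) (`|c|%N%:Z) => x z t; lia.
have h2 : `|i - j|%N%:Z <= `|i|%N%:Z + `|j|%N%:Z by lia.
apply: le_trans h _.
have : D%:Z * `|i - j|%N%:Z <= D%:Z * (`|i|%N%:Z + `|j|%N%:Z) by rewrite ler_wpM2l.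
have hk : k <= `|k|%N%:Z by lia.
have hB' : 0 <= B%:Z * `|i|%N%:Z by [].
have hB2 : 0 <= B%:Z * `|j|%N%:Z by [].
have hD2 : 0 <= D%:Z * `|k|%N%:Z by [].
rewrite /a /b /c.
tri_gen => x; move: (`|i - j|%N) hk hB' hB2 hD2 => ?; lia.
Qed.

Lemma abs_summable_triple_expanded :
  abs_summable (fun t : int * int * int =>
    q ^ (t.1.1 * t.1.1 + t.1.2 * t.1.2 - t.1.1 * t.1.2 + tri (t.2 + 1) - tri (t.1.2 + 1)) *
    y ^ (t.1.2 - t.2) * w ^ (t.1.1 - t.1.2) * u t.1.1 * u t.2 * u (t.1.2 - t.2)).
Proof.
have [B hB] := qbounded_exprz_of q_lt1 q_neq0 y_neq0.
have [D hD] := qbounded_exprz_of q_lt1 q_neq0 w_neq0.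
apply: (qbounded_summable q_lt1 q_neq0 (D := 12) (A := 12 * (B + D) + 6)
  (abs_summable_size3 q_lt1)
  (qboundedM q_neq0 (qboundedM q_neq0 (qboundedM q_neq0 (qboundedM q_neq0 (qboundedM q_neq0
    (qbounded_exprz q (fun t : int * int * int => t.1.1 * t.1.1 + t.1.2 * t.1.2
       - t.1.1 * t.1.2 + tri (t.2 + 1) - tri (t.1.2 + 1)))
    (hB _ (fun t => t.1.2 - t.2))) (hD _ (fun t => t.1.1 - t.1.2)))
    (qbounded_inv_qpoch q_lt1 (fun t => t.1.1)))
    (qbounded_inv_qpoch q_lt1 (fun t => t.2)))
    (qbounded_inv_qpoch q_lt1 (fun t => t.1.2 - t.2)))) => // -[[i j] m] /=.
rewrite !addr0 !PoszD.
(* Despite the negative [tri (j + 1)] the form stays positive definite: twice the exponent is a^2 +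
   b^2 + c^2 + m - j. Here the weights 2, 1, 1 give 6 = 4 + 1 + 1. *)
set a := i; set b := j - i; set c := m.
have h : (`|i|%N%:Z + `|j|%N%:Z + `|m|%N%:Z) ^+ 2 <= 6 * (a * a + b * b + c * c).
  apply: (@le_trans _ _ ((2 * `|a|%N%:Z + `|b|%N%:Z + `|c|%N%:Z) ^+ 2)).
    by apply: lerXn2r; rewrite ?nnegrE; lia.
  have := sqr_ge0 (`|a|%N%:Z - 2 * `|b|%N%:Z).
  have := sqr_ge0 (`|a|%N%:Z - 2 * `|c|%N%:Z).
  have := sqr_ge0 (`|b|%N%:Z - `|c|%N%:Z).
  have abs x : x * x = `|x|%N%:Z * `|x|%N%:Z by nia.
  rewrite (abs a) (abs b) (abs c) !expr2; move: (`|a|%N%:Z) (`|b|%N%:Z) (`|c|%N%:Z) => x z t; lia.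
apply: le_trans h _.
have : D%:Z * `|i - j|%N%:Z <= D%:Z * (`|i|%N%:Z + `|j|%N%:Z).
  by rewrite ler_wpM2l//; lia.
have : B%:Z * `|j - m|%N%:Z <= B%:Z * (`|j|%N%:Z + `|m|%N%:Z).
  by rewrite ler_wpM2l//; lia.
have hk : - m <= `|m|%N%:Z by lia.
have hj : j <= `|j|%N%:Z by lia.
have hi : 0 <= `|i|%N%:Z by lia.
have hB' : 0 <= B%:Z * `|i|%N%:Z by [].
have hD2 : 0 <= D%:Z * `|m|%N%:Z by [].
rewrite /a /b /c.
tri_gen => x ?; move: (`|i - j|%N) (`|j - m|%N) hk hB' hD2 hi hj => ? ?; lia.
Qed.

End TripleSum.

Section TripleSumValue.
Variable R : realType.
Local Notation C := (R[i]).
Variable q y w : C.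
Hypotheses (q_lt1 : `|q| < 1) (q_neq0 : q != 0) (y_neq0 : y != 0) (w_neq0 : w != 0).
Local Notation u := (inv_qpoch q).
Local Notation qD := (fun m n => @expfzDr _ q m n q_neq0).
Local Notation yD := (fun m n => @expfzDr _ y m n y_neq0).
Local Notation wD := (fun m n => @expfzDr _ w m n w_neq0).

(* The sum over k is an Euler product, which the q-binomial theorem turns into a
   finite sum over m; with i = m - d and j = m + l, the sum over m at fixed (d, l)
   is a Durfee sum. *)
Lemma triple_sum_double V :
  has_sum (fun t : int * int * int => triple_term q y w t.1.1 t.1.2 t.2) V ->
  has_sum (fun t : int * int => qpoch_inf (- y) q / qpoch_inf q q *
    (q ^ (t.1 * t.1 + t.1 * t.2 + tri t.2) * w ^ (- (t.1 + t.2)) * y ^ t.2 * u t.2)) V.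
Proof.
move=> hV.
pose G (t : int * int) := q ^ (t.1 * t.1 + t.2 * t.2 - t.1 * t.2) * w ^ (t.1 - t.2) *
  u t.1 * (u t.2 * qpoch_inf (- (y * q ^ (- t.2))) q).
have hG : has_sum G V.
  apply: (has_sum_pair hV) => -[i j] /=.
  have c0 : y * q ^ (- j) != 0 by rewrite mulf_neq0// expfz_neq0.
  have := has_sumZ (q ^ (i * i + j * j - i * j) * w ^ (i - j) * u i * u j)
    (has_sum_euler q_lt1 q_neq0 c0).
  rewrite /G/= mulrA; apply: eq_has_sum => k.
  rewrite /triple_term expfzMl exprz_exp.
  rewrite (_ : i * i + j * j + tri k - i * j - j * k =
    (i * i + j * j - i * j) + tri k + - j * k); last by ring.
  rewrite [q ^ (_ + - j * k)]qD [q ^ (_ + tri k)]qD; ring.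
have hH := has_sum_iterated (abs_summableZ (qpoch_inf (- y) q)
  (abs_summable_triple_expanded q_lt1 q_neq0 y_neq0 w_neq0)) _ hG.
have {}hH := hH _.
apply: (has_sum_pair (f := fun t : int * int * int =>
  qpoch_inf (- y) q * (q ^ (t.1.1 * t.1.1 + t.1.1 * t.1.2 + tri t.1.2) *
   w ^ (- (t.1.1 + t.1.2)) * y ^ t.1.2 * u t.1.2) *
   (q ^ (t.2 * (t.2 + - t.1.1)) * u t.2 * u (t.2 + - t.1.1)))); last first.
  move=> [d l] /=; rewrite [_ / _ * _]mulrAC; exact: has_sumZ (durfee q_lt1 q_neq0 (- d)).
have {hH} := has_sum_reindex
  (h := fun t : int * int * int => (t.2 - t.1.1, t.2 + t.1.2, t.2))
  (h' := fun t : int * int * int => (t.2 - t.1.1, t.1.2 - t.2, t.2)) _ _ (hH _).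
move=> h; apply: eq_has_sum (h _ _ _).
- move=> [[d l] m] /=.
  rewrite (_ : m + l - m = l); last by ring.
  rewrite (_ : m - d - (m + l) = - (d + l)); last by ring.
  rewrite (_ : _ - tri (m + l + 1) = (d * d + d * l + tri l) + m * (m - d)); last by tri_lia.
  rewrite [q ^ (_ + m * (m - d))]qD; ring.
- by move=> [[d l] m] /=; congr (_, _, _); ring.
- by move=> [[d l] m] /=; congr (_, _, _); ring.
move=> [i j] /=.
have := has_sumZ (q ^ (i * i + j * j - i * j) * w ^ (i - j) * u i)
  (has_sum_qbinomial q_lt1 q_neq0 y_neq0 j).
apply: eq_has_sum => m /=.
rewrite (_ : i * i + j * j - i * j + tri (m + 1) - tri (j + 1) =
  (i * i + j * j - i * j) + (tri (m + 1) - tri (j + 1))); last by ring.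
rewrite [q ^ (_ + (_ - tri _))]qD; ring.
Qed.

(* Completing the square: l = 2n or 2n + 1, and d is shifted by n. *)
Theorem triple_sum A B C1 D :
  has_sum (fun d : int => q ^ (d * d) * w ^ (- d)) A ->
  has_sum (fun n : int => q ^ (n * n - n) * (y * y / w) ^ n * u (2 * n)) B ->
  has_sum (fun d : int => q ^ (d * d + d) * w ^ (- d)) C1 ->
  has_sum (fun n : int => q ^ (n * n) * (y * y / w) ^ n * u (2 * n + 1)) D ->
  has_sum (fun t : int * int * int => triple_term q y w t.1.1 t.1.2 t.2)
    (qpoch_inf (- y) q / qpoch_inf q q * (A * B + y / w * (C1 * D))).
Proof.
move=> hA hB hC hD.
have [V hV] := abs_summable_has_sum (abs_summable_triple q_lt1 q_neq0 y_neq0 w_neq0).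
suff -> : qpoch_inf (- y) q / qpoch_inf q q * (A * B + y / w * (C1 * D)) = V by [].
apply: has_sum_unique (triple_sum_double hV); apply: has_sumZ.
have z0 : y * y / w != 0 by rewrite !mulf_neq0// invr_eq0.
have wi0 : w^-1 != 0 by rewrite invr_eq0.
have S1 e z : z != 0 -> abs_summable (fun d : int => q ^ (d * d + e * d) * z ^ d).
  move=> zn; have [N hN] := qbounded_exprz_of q_lt1 q_neq0 zn.
  apply: (qbounded_summable q_lt1 q_neq0 (D := 1) (A := N + `|e|)
    (abs_summable_size1 q_lt1) (qboundedM q_neq0 (qbounded_exprz q _) (hN _ id))) => // k.
  rewrite expr2; nia.
have S2 e a z : z != 0 -> abs_summable (fun d : int => q ^ (d * d + e * d) * z ^ d * u (2 * d + a)).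
  move=> zn; have [N hN] := qbounded_exprz_of q_lt1 q_neq0 zn.
  apply: (qbounded_summable q_lt1 q_neq0 (D := 1) (A := N + `|e|)
    (abs_summable_size1 q_lt1) (qboundedM q_neq0 (qboundedM q_neq0 (qbounded_exprz q _)
      (hN _ id)) (qbounded_inv_qpoch q_lt1 _))) => // k.
  rewrite expr2; nia.
have hAB : has_sum (fun t : int * int => q ^ (t.1 * t.1) * w ^ (- t.1) *
    (q ^ (t.2 * t.2 - t.2) * (y * y / w) ^ t.2 * u (2 * t.2))) (A * B).
  apply: has_sum_prod hA hB.
    apply: (abs_summable_le (c := 1)) (S1 0 _ wi0) => d.
    by rewrite mul0r addr0 exprz_inv mul1r.
  apply: (abs_summable_le (c := 1)) (S2 (-1) 0 _ z0) => d.
  by rewrite mulN1r addr0 mul1r.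
have hCD : has_sum (fun t : int * int => q ^ (t.1 * t.1 + t.1) * w ^ (- t.1) *
    (q ^ (t.2 * t.2) * (y * y / w) ^ t.2 * u (2 * t.2 + 1))) (C1 * D).
  apply: has_sum_prod hC hD.
    apply: (abs_summable_le (c := 1)) (S1 1 _ wi0) => d.
    by rewrite mul1r exprz_inv mul1r.
  apply: (abs_summable_le (c := 1)) (S2 0 1 _ z0) => d.
  by rewrite mul0r addr0 mul1r.
have W (n : int) : (y * y / w) ^ n = y ^ n * y ^ n * w ^ (- n).
  by rewrite !expfzMl exprz_inv.
apply: (@has_sum_parity _ _ _ (fun t : int * int => (t.1 - t.2, 2 * t.2))
  (fun t : int * int => (t.1 - t.2, 2 * t.2 + 1))).
- by move=> [a b] [c d] /= []; move=> h1 h2; congr (_, _); lia.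
- by move=> [a b] [c d] /= []; move=> h1 h2; congr (_, _); lia.
- by move=> [a b]; exists b.
- by move=> [a b]; exists b.
- by move=> d n; exists (d + n, n); rewrite /= addrK.
- by move=> d n; exists (d + n, n); rewrite /= addrK.
- apply: eq_has_sum hAB => -[d n] /=.
  rewrite (_ : _ + tri (2 * n) = d * d + (n * n - n)); last by tri_lia.
  rewrite (_ : - (d - n + 2 * n) = - d + - n); last by ring.
  rewrite (_ : y ^ (2 * n) = y ^ n * y ^ n); last by rewrite -yD; congr (_ ^ _); ring.
  rewrite W [q ^ (d * d + _)]qD [w ^ (- d + _)]wD; ring.
- apply: eq_has_sum (has_sumZ (y / w) hCD) => -[d n] /=.
  rewrite (_ : _ + tri (2 * n + 1) = (d * d + d) + n * n); last by tri_lia.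
  rewrite (_ : - (d - n + (2 * n + 1)) = - d + - n + -1); last by ring.
  rewrite (_ : y ^ (2 * n + 1) = y ^ n * y ^ n * y); last first.
    by rewrite (_ : 2 * n + 1 = n + n + 1) ?yD ?expr1z//; ring.
  rewrite W [q ^ (d * d + d + _)]qD !wD -[w ^ -1]/(w^-1); ring.
Qed.

End TripleSumValue.

(** * The quintuple product and the Rogers-Slater identities *)

Section Quintuple.
Variable R : realType.
Local Notation C := (R[i]).

Lemma norm_exprn_lt1 (q : C) m : `|q| < 1 -> (0 < m)%N -> `|q ^+ m| < 1.
Proof. by move=> q1 m0; rewrite normrX exprn_ilt1// -lt0n. Qed.

(** Factors are sorted by the residue of their exponent modulo m. This is exact for the first m n
    factors, and a subsequence has the same limit. *)
Lemma qpoch_infM (q a : C) (m : nat) : `|q| < 1 -> q != 0 -> a != 0 -> (0 < m)%N ->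
  qpoch_inf a q = \prod_(i < m) qpoch_inf (a * q ^+ i) (q ^+ m).
Proof.
move=> q1 q0 a0 m0; have qm0 : q ^+ m != 0 by rewrite expf_neq0.
have h := seq_cvg_sub (h := fun n => (m * n)%N) (fun n => leq_pmull n m0)
  (qpoch_cvg q1 q0 a0).
apply: seq_cvg_unique h _.
have := seq_cvg_prod (index_enum 'I_m)
  (fun i : 'I_m => qpoch_cvg (norm_exprn_lt1 q1 m0) qm0 (_ : a * q ^+ i != 0)).
move=> /(_ (fun i : 'I_m => mulf_neq0 a0 (expf_neq0 i q0))).
congr seq_cvg; apply/funext => n /=; rewrite /qpoch exchange_big/=.
elim: n => [|n IH]; first by rewrite muln0 !big_ord0.
rewrite big_ord_recr/= IH mulnS addnC big_split_ord/=; congr (_ * _).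
by apply: eq_bigr => i _; rewrite exprD exprM; ring.
Qed.

Lemma has_sum_mod3 (g : int -> C) S T U :
  has_sum (fun s => g (3 * s)) S -> has_sum (fun s => g (3 * s + 1)) T ->
  has_sum (fun s => g (3 * s + 2)) U -> has_sum g (S + T + U).
Proof.
move=> hS hT hU.
pose r (n : int) := n - 3 * (n %/ 3)%Z.
have part a (v : C) : 0 <= a < 3 ->
    has_sum (fun s => g (3 * s + a)) v ->
    has_sum (fun n => if r n == a then g n else 0) v.
  move=> a3 hv.
  have hi : injective (fun s : int => 3 * s + a) by move=> x y; lia.
  apply: (iffRL (has_sum_inj _ hi _)) => [n h|] /=.
    case: eqP => // rn; case: (h (n %/ 3)%Z); rewrite -rn /r; lia.
  apply: eq_has_sum hv => s /=; rewrite (_ : r (3 * s + a) == a)//.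
  by rewrite /r; lia.
have {}hS : has_sum (fun s => g (3 * s + 0)) S.
  by apply: eq_has_sum hS => s; rewrite addr0.
have := has_sumD (has_sumD (part 0 _ isT hS) (part 1 _ isT hT)) (part 2 _ isT hU).
apply: eq_has_sum => n.
have : (r n == 0) || (r n == 1) || (r n == 2) by rewrite /r; lia.
by case/orP => [/orP[]|] /eqP -> /=; rewrite ?addr0 ?add0r.
Qed.

Variable p : C.
Hypotheses (p_lt1 : `|p| < 1) (p_neq0 : p != 0).

Definition theta (p z : C) : C := qpoch_inf z p * qpoch_inf (p / z) p * qpoch_inf p p.

Lemma has_sum_theta (q z : C) : `|q| < 1 -> q != 0 -> z != 0 ->
  has_sum (fun d : int => (-1) ^ d * (q ^ tri d * z ^ d)) (theta q z).
Proof.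
move=> q1 q0 z0; have nz0 : - z != 0 by rewrite oppr_eq0.
have := jacobi_triple q1 q0 nz0; rewrite invrN mulrN !opprK.
by apply: eq_has_sum => d; rewrite -[- z]mulN1r expfzMl mulrCA.
Qed.

(** Euler's pentagonal number theorem in base p^2: (p^2; p^2)_oo = (p^2, p^4, p^6; p^6)_oo is the
    triple product in base p^6 at z = p^2. *)
Lemma has_sum_pentagonal :
  has_sum (fun j : int => (-1) ^ j * p ^ (3 * (j * j) - j)) (qpoch_inf (p ^+ 2) (p ^+ 2)).
Proof.
have p6 : `|p ^+ 6| < 1 by exact: norm_exprn_lt1.
have p60 : p ^+ 6 != 0 by rewrite expf_neq0.
have p20 : p ^+ 2 != 0 by rewrite expf_neq0.
rewrite (@qpoch_infM _ _ 3 (norm_exprn_lt1 p_lt1 _))//.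
rewrite !big_ord_recl big_ord0/= /bump/= mulr1 expr0 mulr1.
rewrite -!exprM -!exprD/=.
have := has_sum_theta p6 p60 p20.
rewrite /theta (_ : p ^+ 6 / p ^+ 2 = p ^+ 4); last first.
  by rewrite (_ : 6 = 4 + 2)%N // exprD mulfK.
rewrite mulrA; apply: eq_has_sum => j; congr (_ * _).
rewrite !exprnP !exprz_exp -expfzDr//; congr (_ ^ _); tri_lia.
Qed.

(* Carlitz and Subbarao: multiply two triple products with indices i and j and
   collect the powers of [z] by n = i + 2j.  The sum over j is a pentagonal
   series if n = 0, 1 mod 3, and cancels in pairs j <-> - j - 2s - 1 if n = 3s + 2. *)
Theorem quintuple z T1 T2 : z != 0 ->
  has_sum (fun s : int => z ^ (3 * s) * p ^ (s * s + tri s)) T1 ->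
  has_sum (fun s : int => z ^ (3 * s + 1) * p ^ (s * s + s + tri s)) T2 ->
  theta p z * theta (p ^+ 2) (p / z ^+ 2) = qpoch_inf (p ^+ 2) (p ^+ 2) * (T1 - T2).
Proof.
move=> z0 h1 h2.
have p2 : `|p ^+ 2| < 1 by exact: norm_exprn_lt1.
have p20 : p ^+ 2 != 0 by rewrite expf_neq0.
have w0 : p / z ^+ 2 != 0 by rewrite mulf_neq0// invr_eq0 expf_neq0.
have ab (q x : C) : `|q| < 1 -> q != 0 -> x != 0 ->
    abs_summable (fun d : int => (-1) ^ d * (q ^ tri d * x ^ d)).
  move=> q1 q0 x0; apply: (abs_summable_le (c := 1)) (abs_summable_theta q1 q0 x0) => d.
  by rewrite normrM norm_exprz normrN1 exp1rz.
set P := qpoch_inf (p ^+ 2) (p ^+ 2).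
have sD (m n : int) : (-1) ^ (m + n) = (-1) ^ m * (-1) ^ n :> C.
  by rewrite expfzDr// oppr_eq0 oner_eq0.
have s2 (n : int) : (-1) ^ (2 * n) = 1 :> C.
  by rewrite -exprz_exp -exprnP sqrrN expr1n exp1rz.
have sN (n : int) : (-1) ^ (- n) = (-1) ^ n :> C by rewrite -exprz_inv invrN invr1.
have s1 : (-1) ^ 1%:Z = -1 :> C by rewrite expr1z.
pose F (t : int * int) := ((-1) ^ t.1 * (p ^ tri t.1 * z ^ t.1)) *
  ((-1) ^ t.2 * ((p ^+ 2) ^ tri t.2 * (p / z ^+ 2) ^ t.2)).
pose f (t : int * int) := (-1) ^ t.1 * (-1) ^ t.2 * z ^ t.1 *
  p ^ (tri (t.1 + 2 * t.2) + t.2 * t.2).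
pose h (t : int * int) := (t.1 + 2 * t.2, t.2).
pose h' (t : int * int) := (t.1 - 2 * t.2, t.2).
have hK : cancel h h' by move=> [n j]; rewrite /h /h'/= addrK.
have h'K : cancel h' h by move=> [n j]; rewrite /h /h'/= subrK.
have fE : F \o h =1 f.
  move=> [n j]; rewrite /f /F /h /=.
  rewrite [(p / z ^+ 2) ^ j]expfzMl exprz_inv !exprnP !exprz_exp.
  rewrite (_ : tri (n + 2 * j) + j * j = tri (n + 2 * j) + 2 * tri j + j); last by tri_lia.
  rewrite [p ^ (_ + j)]expfzDr// [p ^ (_ + 2 * tri j)]expfzDr//.
  rewrite [z ^ (n + 2 * j)]expfzDr// [(-1) ^ (n + 2 * j)]sD s2.
  rewrite (_ : 2 * - j = - (2 * j)) -?invr_expz; last by ring.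
  by have z2 := expfz_neq0 (2 * j) z0; field.
have hf : has_sum f (theta p z * theta (p ^+ 2) (p / z ^+ 2)).
  apply: eq_has_sum fE _; apply: has_sum_reindex hK h'K _.
  exact: has_sum_prod (ab _ _ p_lt1 p_neq0 z0) (ab _ _ p2 p20 w0)
    (has_sum_theta p_lt1 p_neq0 z0) (has_sum_theta p2 p20 w0).
have fa : abs_summable f.
  apply: (abs_summable_le (g := F \o h) (c := 1)) => [x|]; first by rewrite fE mul1r.
  apply: abs_summable_inj (can_inj hK) _.
  exact: abs_summable_prod (ab _ _ p_lt1 p_neq0 z0) (ab _ _ p2 p20 w0).
have row n : exists S, has_sum (fun j => f (n, j)) S.
  by apply/abs_summable_has_sum/(abs_summable_inj _ fa) => i j [].
pose g n := projT1 (cid (row n)).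
have gP n : has_sum (fun j => f (n, j)) (g n) by rewrite /g; case: cid.
(* In terms of j + s the exponent of p is the pentagonal one plus a function of s alone; the rows n
   = 3s + 1 give its reflection under negation of the index. *)
have g0 s : z ^ (3 * s) * p ^ (s * s + tri s) * P = g (3 * s).
  have hs := has_sum_shift s (has_sumZ (z ^ (3 * s) * p ^ (s * s + tri s)) has_sum_pentagonal).
  apply: has_sum_unique (gP _); apply: eq_has_sum hs => j; rewrite /f/=.
  rewrite (_ : tri (3 * s + 2 * j) + j * j =
    (s * s + tri s) + (3 * ((j + s) * (j + s)) - (j + s))); last by tri_lia.
  rewrite (_ : (-1) ^ (3 * s) = (-1) ^ s :> C); last first.
    by rewrite (_ : 3 * s = 2 * s + s) ?sD ?s2 ?mul1r//; ring.
  by rewrite [p ^ (_ + _ + (3 * _ - _))]expfzDr// sD; ring.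
have g1 s : - (z ^ (3 * s + 1) * p ^ (s * s + s + tri s) * P) = g (3 * s + 1).
  have hs := has_sumZ (-1) (has_sum_shift s (has_sumZ (z ^ (3 * s + 1) * p ^ (s * s + s + tri s))
    (has_sum_opp has_sum_pentagonal))).
  rewrite -mulN1r; apply: has_sum_unique (gP _); apply: eq_has_sum hs => j; rewrite /f/=.
  rewrite (_ : tri (3 * s + 1 + 2 * j) + j * j =
    (s * s + s + tri s) + (3 * (- (j + s) * - (j + s)) - - (j + s))); last by tri_lia.
  rewrite (_ : (-1) ^ (3 * s + 1) = - (-1) ^ s :> C); last first.
    rewrite (_ : 3 * s + 1 = 2 * s + s + 1) ?sD ?s2 ?s1 ?mul1r ?mulrN1//; ring.
  by rewrite [p ^ (_ + _ + (3 * _ - _))]expfzDr// sN sD; ring.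
have g2 s : g (3 * s + 2) = 0.
  have inv : cancel (fun j : int => - j - 2 * s - 1) (fun j => - j - 2 * s - 1).
    by move=> j; ring.
  have := has_sum_reindex inv inv (gP (3 * s + 2)).
  have := has_sumZ (-1) (gP (3 * s + 2)) => e1 e2.
  have : -1 * g (3 * s + 2) = g (3 * s + 2).
    apply: has_sum_unique e1 _; apply: eq_has_sum e2 => j; rewrite /f/=.
    rewrite (_ : tri (3 * s + 2 + 2 * (- j - 2 * s - 1)) +
      (- j - 2 * s - 1) * (- j - 2 * s - 1) = tri (3 * s + 2 + 2 * j) + j * j); last by tri_lia.
    rewrite (_ : - j - 2 * s - 1 = - (j + 2 * s + 1)); last by ring.
    by rewrite sN !sD s2 s1; ring.
  move/eqP; rewrite mulN1r eqNr => /eqP ->//.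
have := has_sum_mod3 (g := g) (S := P * T1) (T := - (P * T2)) (U := 0).
rewrite addr0 -mulrBr => hg; apply: has_sum_unique (has_sum_pair hf gP) (hg _ _ _).
- by apply: eq_has_sum (has_sumZ P h1) => s; rewrite -g0 mulrC.
- rewrite -mulN1r; apply: eq_has_sum (has_sumZ (-1) (has_sumZ P h2)) => s.
  by rewrite -g1 mulN1r mulrC.
- by apply: has_sum0.
Qed.

End Quintuple.

(** * Bailey's lemma and finite forms of the Rogers-Slater identities *)

Section Bailey.
Variable R : realType.
Local Notation C := (R[i]).
Variable q : C.
Hypotheses (q_lt1 : `|q| < 1) (q_neq0 : q != 0).
Local Notation u := (inv_qpoch q).
Local Notation qD := (fun m n => @expfzDr _ q m n q_neq0).

(** Bilateral form of Slater's Bailey pairs of group A: the two indices move apart in steps of 3.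
    With sum a + b equal to 0 or 1, the offsets select the residue class modulo 3 and the pair
    parameter 1 or q. *)
Definition bailey_term (E c a b n r : int) : C :=
  q ^ (6 * (r * r) + E * r + c) * u (n + a - 3 * r) * u (n + b + 3 * r).

Lemma abs_summable_bailey E c a b n : abs_summable (bailey_term E c a b n).
Proof.
apply: (qbounded_summable q_lt1 q_neq0 (D := 1) (A := `|E| + `|c|)
  (abs_summable_size1 q_lt1)
  (qboundedM q_neq0 (qboundedM q_neq0
    (qbounded_exprz q (fun r => 6 * (r * r) + E * r + c))
    (qbounded_inv_qpoch q_lt1 (fun r => n + a - 3 * r)))
    (qbounded_inv_qpoch q_lt1 (fun r => n + b + 3 * r)))) => // r.
rewrite !addr0 expr2; nia.
Qed.

Lemma bailey_neg E c a b n S : 2 * n + a + b < 0 ->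
  has_sum (bailey_term E c a b n) S -> S = 0.
Proof.
move=> n0 hS; apply: has_sum_unique hS _; apply: has_sum0 => r.
rewrite /bailey_term; have [h|h] := ltP (n + a - 3 * r) 0.
  by rewrite (inv_qpoch_lt0 _ h) mulr0 mul0r.
by rewrite (@inv_qpoch_lt0 _ _ (n + b + 3 * r)) ?mulr0//; lia.
Qed.

(* After exchanging the summations, the sum over [n] is a Durfee sum. *)
Lemma bailey_lemma E c a b (g : int -> C) T :
  (forall n, has_sum (bailey_term E c a b n) (g n)) ->
  has_sum (fun r : int => q ^ (15 * (r * r) + (E + 3 * (b - a)) * r + (c - a * b))) T ->
  has_sum (fun n : int => q ^ (n * n + (a + b) * n) * g n) (T / qpoch_inf q q).
Proof.
move=> hg hT.
pose F (t : int * int) := q ^ (t.1 * t.1 + (a + b) * t.1) * bailey_term E c a b t.1 t.2.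
have Fa : abs_summable F.
  apply: (qbounded_summable q_lt1 q_neq0 (D := 2) (A := 2 * (`|E| + `|c| + `|a| + `|b|))
    (abs_summable_size2 q_lt1)
    (qboundedM q_neq0 (qbounded_exprz q (fun t : int * int => t.1 * t.1 + (a + b) * t.1))
      (qboundedM q_neq0 (qboundedM q_neq0
      (qbounded_exprz q (fun t => 6 * (t.2 * t.2) + E * t.2 + c))
      (qbounded_inv_qpoch q_lt1 (fun t => t.1 + a - 3 * t.2)))
      (qbounded_inv_qpoch q_lt1 (fun t => t.1 + b + 3 * t.2))))) => // -[n r] /=.
  rewrite !addr0 expr2 PoszD.
  have h1 : - (E * r) <= `|E|%N%:Z * `|r|%N%:Z by nia.
  have h2 : - (a * n) <= `|a|%N%:Z * `|n|%N%:Z by nia.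
  have h3 : - (b * n) <= `|b|%N%:Z * `|n|%N%:Z by nia.
  have h4 : n * n = `|n|%N%:Z * `|n|%N%:Z by nia.
  have h5 : r * r = `|r|%N%:Z * `|r|%N%:Z by nia.
  have h6 : - c <= `|c|%N%:Z by lia.
  have h7 := sqr_ge0 (`|n|%N%:Z - `|r|%N%:Z); rewrite expr2 in h7.
  rewrite !PoszM !PoszD mulrDl h4 h5.
  move: h1 h2 h3 h6 h7.
  have k1 : 0 <= `|E|%N%:Z * `|n|%N%:Z by [].
  have k2 : 0 <= `|c|%N%:Z * `|n|%N%:Z by [].
  have k3 : 0 <= `|c|%N%:Z * `|r|%N%:Z by [].
  have k4 : 0 <= `|a|%N%:Z * `|r|%N%:Z by [].
  have k5 : 0 <= `|b|%N%:Z * `|r|%N%:Z by [].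
  have k6 : 0 <= `|r|%N%:Z * `|r|%N%:Z by [].
  have e1 : 0 <= `|E|%N%:Z by [].
  have e2 : 0 <= `|a|%N%:Z by [].
  have e3 : 0 <= `|b|%N%:Z by [].
  move: k1 k2 k3 k4 k5 k6 e1 e2 e3.
  move: (`|n|%N%:Z) (`|r|%N%:Z) (`|E|%N%:Z) (`|c|%N%:Z) (`|a|%N%:Z) (`|b|%N%:Z) => *.
  lia.
have [V hV] := abs_summable_has_sum Fa.
have hV' := has_sum_pair hV (fun n => has_sumZ (q ^ (n * n + (a + b) * n)) (hg n)).
suff <- : V = T / qpoch_inf q q by [].
have hW : has_sum (fun t : int * int => F (t.2, t.1)) V.
  by apply: (has_sum_reindex (h := fun t : int * int => (t.2, t.1))
    (h' := fun t => (t.2, t.1)) _ _ hV) => -[].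
have hr r : has_sum (fun n => F (n, r))
    (q ^ (15 * (r * r) + (E + 3 * (b - a)) * r + (c - a * b)) / qpoch_inf q q).
  (* The product (n + a - 3r)(n + b + 3r) is the Durfee exponent. Splitting it off from n^2 + (a +
     b) n leaves 9 r^2 + 3 (b - a) r - a b, whence 15 = 6 + 9. *)
  have := has_sumZ (q ^ (15 * (r * r) + (E + 3 * (b - a)) * r + (c - a * b)))
    (has_sum_shift (a - 3 * r) (durfee q_lt1 q_neq0 (b - a + 6 * r))).
  apply: eq_has_sum => n; rewrite /F/= /bailey_term.
  rewrite [n + (a - 3 * r)]addrA.
  rewrite (_ : n + a - 3 * r + (b - a + 6 * r) = n + b + 3 * r); last by ring.
  rewrite !mulrA -!qD; congr (q ^ _ * _ * _); ring.
apply: has_sum_unique (has_sum_pair hW hr) _; rewrite [T / _]mulrC.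
by apply: eq_has_sum (has_sumZ (qpoch_inf q q)^-1 hT) => r; rewrite mulrC.
Qed.

(* Each term of one series splits, by u(n - 1) = (1 - q^n) u(n), into a term of the
   other series and a remainder; the remainders of the two halves agree up to a
   reflection of [r]. *)
Lemma bailey_step0 (n : nat) X1 X2 Y1 Y2 :
  has_sum (bailey_term 1 0 0 0 n) X1 -> has_sum (bailey_term 5 1 (-1) 1 n) X2 ->
  has_sum (bailey_term 1 0 0 1 n) Y1 -> has_sum (bailey_term 7 2 (-1) 2 n) Y2 ->
  (1 - q ^ (2 * n%:Z + 1)) * (Y1 - Y2) = X1 - X2.
Proof.
move=> h1 h2 h3 h4.
have [Z hZ] := abs_summable_has_sum (abs_summable_bailey 4 (n%:Z + 1) (-1) 1 n).
have E1 : (1 - q ^ (2 * n%:Z + 1)) * Y1 = X1 + Z.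
  apply: has_sum_unique (has_sumZ _ h3) _.
  apply: eq_has_sum (has_sumD h1 hZ) => r; rewrite /bailey_term.
  set i := n%:Z + 0 - 3 * r; set m := n%:Z + 1 + 3 * r.
  rewrite (_ : n%:Z + 0 + 3 * r = m - 1); last by rewrite /m; ring.
  rewrite (_ : n%:Z + -1 - 3 * r = i - 1); last by rewrite /i; ring.
  rewrite -!inv_qpoch_rec//.
  rewrite (_ : 2 * n%:Z + 1 = i + m); last by rewrite /m /i; ring.
  rewrite (_ : 6 * (r * r) + 4 * r + (n%:Z + 1) = 6 * (r * r) + 1 * r + 0 + m); last by rewrite /m; ring.
  by clearbody i m; rewrite !qD; ring.
have E2 : (1 - q ^ (2 * n%:Z + 1)) * Y2 = X2 + Z.
  apply: has_sum_unique (has_sumZ _ h4) _.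
  have h2' := has_sum_reindex (subKr _) (subKr _) h2.
  apply: eq_has_sum (has_sumD (h2' (-1)) hZ) => r; rewrite /= /bailey_term.
  set i := n%:Z + -1 - 3 * r; set m := n%:Z + 2 + 3 * r.
  rewrite (_ : n%:Z + 1 + 3 * (-1 - r) = i - 1); last by rewrite /i; ring.
  rewrite (_ : n%:Z + -1 - 3 * (-1 - r) = m); last by rewrite /m; ring.
  rewrite (_ : n%:Z + 1 + 3 * r = m - 1); last by rewrite /m; ring.
  rewrite -!inv_qpoch_rec//.
  rewrite (_ : 2 * n%:Z + 1 = i + m); last by rewrite /m /i; ring.
  rewrite (_ : 6 * (r * r) + 4 * r + (n%:Z + 1) = 6 * (r * r) + 7 * r + 2 + i); last by rewrite /i; ring.
  rewrite (_ : 6 * ((-1 - r) * (-1 - r)) + 5 * (-1 - r) + 1 = 6 * (r * r) + 7 * r + 2); last by ring.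
  by clearbody i m; rewrite !qD; ring.
by rewrite mulrBr E1 E2; ring.
Qed.

(** The companion rung of the ladder 2n, 2n + 1, 2n + 2: it passes from the odd sums at n to the
    even sums at n + 1, with the factor by which [inv_qpoch] changes between those indices. *)
Lemma bailey_step1 (n : nat) X1 X2 Y1 Y2 :
  has_sum (bailey_term 1 0 0 0 n.+1) X1 -> has_sum (bailey_term 5 1 (-1) 1 n.+1) X2 ->
  has_sum (bailey_term 1 0 0 1 n) Y1 -> has_sum (bailey_term 7 2 (-1) 2 n) Y2 ->
  (1 - q ^ (2 * n.+1%:Z)) * (X1 - X2) = Y1 - Y2.
Proof.
move=> h1 h2 h3 h4.
have [Z hZ] := abs_summable_has_sum (abs_summable_bailey (-2) (n%:Z + 1) 1 0 n).
have E1 : (1 - q ^ (2 * n.+1%:Z)) * X1 = Y1 + Z.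
  apply: has_sum_unique (has_sumZ _ h1) _.
  apply: eq_has_sum (has_sumD h3 hZ) => r; rewrite /bailey_term.
  set i := n.+1%:Z + 0 - 3 * r; set m := n.+1%:Z + 0 + 3 * r.
  rewrite (_ : n%:Z + 0 - 3 * r = i - 1); last by rewrite /i; lia.
  rewrite (_ : n%:Z + 1 + 3 * r = m); last by rewrite /m; lia.
  rewrite (_ : n%:Z + 1 - 3 * r = i); last by rewrite /i; lia.
  rewrite (_ : n%:Z + 0 + 3 * r = m - 1); last by rewrite /m; lia.
  rewrite -!inv_qpoch_rec//.
  rewrite (_ : 2 * n.+1%:Z = i + m); last by rewrite /m /i; ring.
  rewrite (_ : 6 * (r * r) + -2 * r + (n%:Z + 1) = 6 * (r * r) + 1 * r + 0 + i); last by rewrite /i; lia.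
  by clearbody i m; rewrite !qD; ring.
have E2 : (1 - q ^ (2 * n.+1%:Z)) * X2 = Y2 + Z.
  apply: has_sum_unique (has_sumZ _ h2) _.
  have h4' := has_sum_reindex (subKr _) (subKr _) h4.
  apply: eq_has_sum (has_sumD (h4' (-1)) (has_sum_opp hZ)) => r; rewrite /= /bailey_term.
  set i := n.+1%:Z + -1 - 3 * r; set m := n.+1%:Z + 1 + 3 * r.
  rewrite (_ : n%:Z + -1 - 3 * (-1 - r) = m); last by rewrite /m; lia.
  rewrite (_ : n%:Z + 2 + 3 * (-1 - r) = i - 1); last by rewrite /i; lia.
  rewrite (_ : n%:Z + 1 - 3 * - r = m - 1); last by rewrite /m; lia.
  rewrite (_ : n%:Z + 0 + 3 * - r = i); last by rewrite /i; lia.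
  rewrite -!inv_qpoch_rec//.
  rewrite (_ : 2 * n.+1%:Z = i + m); last by rewrite /m /i; ring.
  rewrite (_ : 6 * (- r * - r) + -2 * - r + (n%:Z + 1) = 6 * (r * r) + 5 * r + 1 + i); last by rewrite /i; lia.
  rewrite (_ : 6 * ((-1 - r) * (-1 - r)) + 7 * (-1 - r) + 2 = 6 * (r * r) + 5 * r + 1); last by ring.
  by clearbody i m; rewrite !qD; ring.
by rewrite mulrBr E1 E2; ring.
Qed.

(** The differences obey the same first-order recurrences as 1/(q)_(2n) and 1/(q)_(2n+1), so both
    identities climb together. At n = 0 only the term r = 0 of [X1] survives; for negative n
    everything vanishes. *)
Lemma finite_slater (n : int) X1 X2 Y1 Y2 :
  has_sum (bailey_term 1 0 0 0 n) X1 -> has_sum (bailey_term 5 1 (-1) 1 n) X2 ->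
  has_sum (bailey_term 1 0 0 1 n) Y1 -> has_sum (bailey_term 7 2 (-1) 2 n) Y2 ->
  X1 - X2 = u (2 * n) /\ Y1 - Y2 = u (2 * n + 1).
Proof.
case: n => n; last first.
  move=> h1 h2 h3 h4; rewrite !(inv_qpoch_lt0 q (n := 2 * Negz n)) ?(inv_qpoch_lt0 q (n := 2 * Negz n + 1)); try lia.
  rewrite (bailey_neg _ h1) ?(bailey_neg _ h2) ?(bailey_neg _ h3) ?(bailey_neg _ h4) ?subrr//; lia.
have odd m X1' X2' Y1' Y2' : has_sum (bailey_term 1 0 0 0 (Posz m)) X1' ->
    has_sum (bailey_term 5 1 (-1) 1 m) X2' ->
    has_sum (bailey_term 1 0 0 1 m) Y1' -> has_sum (bailey_term 7 2 (-1) 2 m) Y2' ->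
    X1' - X2' = u (2 * m) -> Y1' - Y2' = u (2 * m%:Z + 1).
  move=> h1 h2 h3 h4 hX; have := bailey_step0 h1 h2 h3 h4.
  rewrite hX (_ : Posz (2 * m) = 2 * m%:Z + 1 - 1); last by lia.
  rewrite -inv_qpoch_rec// => /mulfI -> //.
  have := one_sub_exprn_neq0 q_lt1 (2 * m); rewrite exprnP.
  by rewrite (_ : Posz (2 * m).+1 = 2 * m%:Z + 1)//; lia.
elim: n X1 X2 Y1 Y2 => [|n IH] X1 X2 Y1 Y2 h1 h2 h3 h4.
  suff h : X1 - X2 = u (2 * 0) by split; [|exact: odd h1 h2 h3 h4 h].
  have -> : X2 = 0.
    apply: has_sum_unique h2 _; apply: has_sum0 => r; rewrite /bailey_term.
    have [h|h] := ltP (0%:Z + -1 - 3 * r) 0; first by rewrite (inv_qpoch_lt0 _ h) mulr0 mul0r.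
    by rewrite (@inv_qpoch_lt0 _ _ (0%:Z + 1 + 3 * r)) ?mulr0//; lia.
  have -> : X1 = bailey_term 1 0 0 0 0 0.
    apply: has_sum_unique h1 _; apply: has_sum_single => r r0; rewrite /bailey_term.
    have [h|h] := ltP (0%:Z + 0 - 3 * r) 0; first by rewrite (inv_qpoch_lt0 _ h) mulr0 mul0r.
    by rewrite (@inv_qpoch_lt0 _ _ (0%:Z + 0 + 3 * r)) ?mulr0//; lia.
  by rewrite subr0 /bailey_term mulr0 expr0z !inv_qpoch0 !mul1r.
have ex E c a b m : exists S, has_sum (bailey_term E c a b m) S.
  exact/abs_summable_has_sum/abs_summable_bailey.
have [X1' h1'] := ex 1 0 0 0 n; have [X2' h2'] := ex 5 1 (-1) 1 n.
have [Y1' h3'] := ex 1 0 0 1 n; have [Y2' h4'] := ex 7 2 (-1) 2 n.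
have [_ hY] := IH _ _ _ _ h1' h2' h3' h4'.
suff h : X1 - X2 = u (2 * n.+1) by split => //; exact: odd h1 h2 h3 h4 h.
have := bailey_step1 h1 h2 h3' h4'.
rewrite hY (_ : 2 * n%:Z + 1 = 2 * n.+1%:Z - 1); last by lia.
rewrite -inv_qpoch_rec// => /mulfI -> //.
have := one_sub_exprn_neq0 q_lt1 (n + n.+1); rewrite exprnP.
by rewrite (_ : Posz (n + n.+1).+1 = 2 * n.+1%:Z)//; lia.
Qed.

End Bailey.

Lemma etaJE (K : numFieldType) (q : K) m : etaJ q m = qpoch_inf (q ^+ m) (q ^+ m).
Proof. by []. Qed.

(* Unification would otherwise compare distinct products by unfolding limits. *)
#[global] Opaque qpoch_inf etaJ.

(** * Slater's identities 79, 94, 96 and 99 *)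

Section Slater.
Variable R : realType.
Local Notation C := (R[i]).
Variable q : C.
Hypotheses (q_lt1 : `|q| < 1) (q_neq0 : q != 0).
Local Notation u := (inv_qpoch q).
Local Notation qD := (fun m n => @expfzDr _ q m n q_neq0).

(** Split each term by 1 = q^m + (1 - q^m), where m is one of its two Pochhammer indices: the first
    part is q^n times a term of the pair for 1/(q)_(2n), the second lowers m by 1. The second parts
    of [X1] and [X2] are the same series [Z] up to r -> -r and cancel. *)
Lemma finite_slater_even (n : int) X1 X2 :
  has_sum (bailey_term q 2 0 0 0 n) X1 -> has_sum (bailey_term q 2 0 (-1) 1 n) X2 ->
  X1 - X2 = q ^ n * u (2 * n).
Proof.
move=> h1 h2.
have ex E c a b : exists S, has_sum (bailey_term q E c a b n) S.
  exact/abs_summable_has_sum/abs_summable_bailey.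
have [A hA] := ex 1 0 0 0; have [B hB] := ex 5 1 (-1) 1.
have [Y1 hY1] := ex 1 0 0 1; have [Y2 hY2] := ex 7 2 (-1) 2.
have [Z hZ] := ex (-2) 0 0 (-1).
have [<- _] := finite_slater q_lt1 q_neq0 hA hB hY1 hY2.
have -> : X1 = q ^ n * A + Z.
  apply: has_sum_unique (has_sum_opp h1) _.
  apply: eq_has_sum (has_sumD (has_sumZ (q ^ n) hA) hZ) => r; rewrite /bailey_term.
  rewrite (_ : n + 0 - 3 * - r = n + 0 + 3 * r); last by ring.
  rewrite (_ : n + 0 + 3 * - r = n + 0 - 3 * r); last by ring.
  rewrite (_ : n + -1 + 3 * r = n + 0 + 3 * r - 1); last by ring.
  rewrite -inv_qpoch_rec// [n + 0]addr0.
  rewrite (_ : 6 * (- r * - r) + 2 * - r + 0 = 6 * (r * r) + -2 * r + 0); last by ring.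
  rewrite (_ : 6 * (r * r) + 1 * r + 0 = 6 * (r * r) + -2 * r + 0 + 3 * r); last by ring.
  rewrite [q ^ (_ + 0 + 3 * r)]qD [q ^ (n + 3 * r)]qD; ring.
have -> : X2 = q ^ n * B + Z.
  apply: has_sum_unique h2 _.
  apply: eq_has_sum (has_sumD (has_sumZ (q ^ n) hB) (has_sum_opp hZ)) => r; rewrite /bailey_term.
  rewrite (_ : n + 0 - 3 * - r = n + 1 + 3 * r - 1); last by ring.
  rewrite (_ : n + -1 + 3 * - r = n + -1 - 3 * r); last by ring.
  rewrite -inv_qpoch_rec//.
  rewrite (_ : 6 * (- r * - r) + -2 * - r + 0 = 6 * (r * r) + 2 * r + 0); last by ring.
  rewrite (_ : 6 * (r * r) + 5 * r + 1 = 6 * (r * r) + 2 * r + 0 + (1 + 3 * r)); last by ring.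
  rewrite -[n + 1 + 3 * r]addrA [q ^ (_ + 0 + (1 + 3 * r))]qD [q ^ (n + (1 + 3 * r))]qD; ring.
by ring.
Qed.

(** The same splitting, with m = n - 3r in [Y1] and m = n + 2 + 3r in [Y2]; the remainders agree
    term by term. *)
Lemma finite_slater_odd (n : int) Y1 Y2 :
  has_sum (bailey_term q 4 0 0 1 n) Y1 -> has_sum (bailey_term q 4 0 (-1) 2 n) Y2 ->
  Y1 - Y2 = q ^ n * u (2 * n + 1).
Proof.
move=> h1 h2.
have ex E c a b : exists S, has_sum (bailey_term q E c a b n) S.
  exact/abs_summable_has_sum/abs_summable_bailey.
have [A hA] := ex 1 0 0 0; have [B hB] := ex 5 1 (-1) 1.
have [D1 hD1] := ex 1 0 0 1; have [D2 hD2] := ex 7 2 (-1) 2.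
have [Z hZ] := ex 4 0 (-1) 1.
have [_ <-] := finite_slater q_lt1 q_neq0 hA hB hD1 hD2.
have -> : Y1 = q ^ n * D1 + Z.
  apply: has_sum_unique h1 _.
  apply: eq_has_sum (has_sumD (has_sumZ (q ^ n) hD1) hZ) => r; rewrite /bailey_term.
  rewrite [n + 0]addr0 (_ : n + -1 - 3 * r = n - 3 * r - 1); last by ring.
  rewrite -inv_qpoch_rec//.
  rewrite (_ : 6 * (r * r) + 1 * r + 0 = 6 * (r * r) + 4 * r + 0 - 3 * r); last by ring.
  rewrite [q ^ (_ + 0 - 3 * r)]qD [q ^ (n - 3 * r)]qD; ring.
have -> : Y2 = q ^ n * D2 + Z.
  apply: has_sum_unique h2 _.
  apply: eq_has_sum (has_sumD (has_sumZ (q ^ n) hD2) hZ) => r; rewrite /bailey_term.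
  rewrite (_ : n + 1 + 3 * r = n + 2 + 3 * r - 1); last by ring.
  rewrite -inv_qpoch_rec//.
  rewrite (_ : 6 * (r * r) + 7 * r + 2 = 6 * (r * r) + 4 * r + 0 + (2 + 3 * r)); last by ring.
  rewrite -[n + 2 + 3 * r]addrA [q ^ (_ + 0 + (2 + 3 * r))]qD [q ^ (n + (2 + 3 * r))]qD; ring.
by ring.
Qed.

Lemma bailey_sum E1 c1 a1 b1 E2 c2 a2 b2 (e : int) (F : int -> C) T1 T2 :
  a1 + b1 = e -> a2 + b2 = e ->
  (forall n X1 X2, has_sum (bailey_term q E1 c1 a1 b1 n) X1 ->
     has_sum (bailey_term q E2 c2 a2 b2 n) X2 -> X1 - X2 = F n) ->
  has_sum (fun r : int => q ^ (15 * (r * r) + (E1 + 3 * (b1 - a1)) * r + (c1 - a1 * b1))) T1 ->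
  has_sum (fun r : int => q ^ (15 * (r * r) + (E2 + 3 * (b2 - a2)) * r + (c2 - a2 * b2))) T2 ->
  has_sum (fun n : int => q ^ (n * n + e * n) * F n) ((T1 - T2) / qpoch_inf q q).
Proof.
move=> e1 e2 hF h1 h2.
have ex E c a b n : {S | has_sum (bailey_term q E c a b n) S}.
  exact/cid/abs_summable_has_sum/abs_summable_bailey.
pose g E c a b n := projT1 (ex E c a b n).
have gP E c a b n : has_sum (bailey_term q E c a b n) (g E c a b n).
  exact: (projT2 (ex E c a b n)).
have k1 := bailey_lemma q_lt1 q_neq0 (gP E1 c1 a1 b1) h1.
have k2 := bailey_lemma q_lt1 q_neq0 (gP E2 c2 a2 b2) h2.
rewrite mulrBl -mulN1r; apply: eq_has_sum (has_sumD k1 (has_sumZ (-1) k2)) => n.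
by rewrite -(hF _ _ _ (gP _ _ _ _ n) (gP _ _ _ _ n)) e1 e2; ring.
Qed.

Lemma etaJ_neq0 m : (0 < m)%N -> etaJ q m != 0.
Proof.
by move=> m0; rewrite etaJE; apply: qpoch_inf_neq0; [exact: norm_exprn_lt1|rewrite expf_neq0].
Qed.

Lemma thetaJE a m : (a <= m)%N -> thetaJ q a m = theta (q ^+ m) (q ^+ a).
Proof.
move=> am; rewrite /thetaJ /qpoch_infs !big_cons big_nil mulr1 /theta mulrA.
by rewrite -[in q ^+ m / _](subnK am) exprD mulfK// expf_neq0.
Qed.

(** The quintuple product with p = q^10 and z = q^a: there p^(s^2 + tri s) = q^(15 s^2 - 5 s), the
    same leading coefficient 15 as in Bailey's lemma. *)
Lemma quintuple_thetaJ (a : nat) T1 T2 : (2 * a < 10)%N ->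
  has_sum (fun s : int => q ^ (15 * (s * s) + (3 * a%:Z - 5) * s)) T1 ->
  has_sum (fun s : int => q ^ (15 * (s * s) + (3 * a%:Z + 5) * s + a%:Z)) T2 ->
  thetaJ q a 10 * thetaJ q (10 - 2 * a) 20 = etaJ q 20 * (T1 - T2).
Proof.
move=> a10 h1 h2.
have p1 : `|q ^+ 10| < 1 by exact: norm_exprn_lt1.
have p0 : q ^+ 10 != 0 by rewrite expf_neq0.
have z0 : q ^+ a != 0 by rewrite expf_neq0.
have := quintuple (p := q ^+ 10) p1 p0 (T1 := T1) (T2 := T2) z0.
rewrite etaJE !thetaJE; [|lia|lia].
rewrite -!exprM.
rewrite (_ : q ^+ 10 / q ^+ (a * 2) = q ^+ (10 - 2 * a)); last first.
  by rewrite -[in q ^+ 10 / _](subnK (ltnW a10)) exprD mulnC mulfK// expf_neq0.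
apply.
  apply: eq_has_sum h1 => s; rewrite !exprnP !exprz_exp -qD; congr (_ ^ _); tri_lia.
apply: eq_has_sum h2 => s; rewrite !exprnP !exprz_exp -qD; congr (_ ^ _); tri_lia.
Qed.

Lemma quadratic_has_sum (b c : int) : exists T,
  has_sum (fun s : int => q ^ (15 * (s * s) + b * s + c)) T.
Proof.
apply: abs_summable_has_sum.
apply: (qbounded_summable q_lt1 q_neq0 (D := 1) (A := `|b| + `|c|)
  (abs_summable_size1 q_lt1) (qbounded_exprz q _)) => // s.
rewrite expr2; nia.
Qed.

Lemma quintuple_quotient a T : (2 * a < 10)%N ->
  thetaJ q a 10 * thetaJ q (10 - 2 * a) 20 = etaJ q 20 * T ->
  T / qpoch_inf q q = thetaJ q a 10 * thetaJ q (10 - 2 * a) 20 / (etaJ q 20 * etaJ q 1).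
Proof.
move=> _ ->; have e1 := etaJ_neq0 (isT : 0 < 1)%N; have e20 := etaJ_neq0 (isT : 0 < 20)%N.
rewrite -[X in qpoch_inf X X]expr1 -etaJE.
by move: (etaJ q 1) (etaJ q 20) T e1 e20 => x y t e1 e20; field; rewrite e1 e20.
Qed.

Theorem slater79 : has_sum (fun n : int => q ^ (n * n) * u (2 * n))
  (thetaJ q 2 10 * thetaJ q 6 20 / (etaJ q 20 * etaJ q 1)).
Proof.
(* The coefficients are E + 3 (b - a) and c - a b for the two halves of the Bailey pair; they match
   the quintuple product at a = 2. *)
have [T1 h1] := quadratic_has_sum 1 0; have [T2 h2] := quadratic_has_sum 11 2.
rewrite -(quintuple_quotient (a := 2) (T := T1 - T2) isT); last first.
  apply: (quintuple_thetaJ (a := 2) isT _ h2).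
  by apply: eq_has_sum h1 => s; rewrite addr0.
have := bailey_sum (E1 := 1) (c1 := 0) (a1 := 0) (b1 := 0) (E2 := 5) (c2 := 1) (a2 := -1)
  (b2 := 1) (e := 0) (F := fun n => u (2 * n)) (T1 := T1) (T2 := T2) erefl erefl _ h1 h2.
move=> h; apply: eq_has_sum (h _) => n; first by rewrite mul0r addr0.
move=> X1 X2 hX1 hX2.
have [Y1 hY1] := abs_summable_has_sum (abs_summable_bailey q_lt1 q_neq0 1 0 0 1 n).
have [Y2 hY2] := abs_summable_has_sum (abs_summable_bailey q_lt1 q_neq0 7 2 (-1) 2 n).
by have [] := finite_slater q_lt1 q_neq0 hX1 hX2 hY1 hY2.
Qed.

Theorem slater94 : has_sum (fun n : int => q ^ (n * n + n) * u (2 * n + 1))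
  (thetaJ q 3 10 * thetaJ q 4 20 / (etaJ q 20 * etaJ q 1)).
Proof.
have [T1 h1] := quadratic_has_sum 4 0; have [T2 h2] := quadratic_has_sum 16 4.
rewrite -(quintuple_quotient (a := 3) (T := T1 - T2) isT); last first.
  apply: (quintuple_thetaJ (a := 3) isT).
    by apply: eq_has_sum h1 => s; rewrite addr0.
  (* The reflection s -> -1 - s turns 15 s^2 + 16 s + 4 into 15 s^2 + 14 s + 3, the exponent of the
     quintuple product at a = 3. *)
  apply: eq_has_sum (has_sum_reindex (subKr (-1)) (subKr (-1)) h2) => s /=.
  by congr (_ ^ _); ring.
have := bailey_sum (E1 := 1) (c1 := 0) (a1 := 0) (b1 := 1) (E2 := 7) (c2 := 2) (a2 := -1)
  (b2 := 2) (e := 1) (F := fun n => u (2 * n + 1)) (T1 := T1) (T2 := T2) erefl erefl _ h1 h2.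
move=> h; apply: eq_has_sum (h _) => n; first by rewrite mul1r.
move=> Y1 Y2 hY1 hY2.
have [X1 hX1] := abs_summable_has_sum (abs_summable_bailey q_lt1 q_neq0 1 0 0 0 n).
have [X2 hX2] := abs_summable_has_sum (abs_summable_bailey q_lt1 q_neq0 5 1 (-1) 1 n).
by have [] := finite_slater q_lt1 q_neq0 hX1 hX2 hY1 hY2.
Qed.

Theorem slater99 : has_sum (fun n : int => q ^ (n * n + n) * u (2 * n))
  (thetaJ q 1 10 * thetaJ q 8 20 / (etaJ q 20 * etaJ q 1)).
Proof.
have [T1 h1] := quadratic_has_sum 2 0; have [T2 h2] := quadratic_has_sum 8 1.
rewrite -(quintuple_quotient (a := 1) (T := T1 - T2) isT); last first.
  apply: (quintuple_thetaJ (a := 1) isT _ h2).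
  by apply: eq_has_sum (has_sum_opp h1) => s; congr (_ ^ _); ring.
have := bailey_sum (E1 := 2) (c1 := 0) (a1 := 0) (b1 := 0) (E2 := 2) (c2 := 0) (a2 := -1)
  (b2 := 1) (e := 0) (T1 := T1) (T2 := T2) erefl erefl finite_slater_even h1 h2.
by apply: eq_has_sum => n; rewrite mulrA -qD; congr (_ ^ _ * _); ring.
Qed.

Theorem slater96 : has_sum (fun n : int => q ^ (n * n + 2 * n) * u (2 * n + 1))
  (thetaJ q 4 10 * thetaJ q 2 20 / (etaJ q 20 * etaJ q 1)).
Proof.
have [T1 h1] := quadratic_has_sum 7 0; have [T2 h2] := quadratic_has_sum 13 2.
rewrite -(quintuple_quotient (a := 4) (T := T1 - T2) isT); last first.
  apply: (quintuple_thetaJ (a := 4) isT).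
    by apply: eq_has_sum h1 => s; rewrite addr0.
  apply: eq_has_sum (has_sum_reindex (subKr (-1)) (subKr (-1)) h2) => s /=.
  by congr (_ ^ _); ring.
have := bailey_sum (E1 := 4) (c1 := 0) (a1 := 0) (b1 := 1) (E2 := 4) (c2 := 0) (a2 := -1)
  (b2 := 2) (e := 1) (T1 := T1) (T2 := T2) erefl erefl finite_slater_odd h1 h2.
by apply: eq_has_sum => n; rewrite mulrA -qD; congr (_ ^ _ * _); ring.
Qed.

End Slater.

(** * Theta series and Pochhammer products as quotients of the J_m *)

Section ThetaAlgebra.
Variable F : fieldType.
Implicit Types a b c d x y : F.

Lemma eq_divr a b c : a != 0 -> a * b = c -> b = c / a.
Proof. by move=> a0 <-; rewrite mulrC mulKf. Qed.

(** Here [x1], [x2], [x4] stand for J_1, J_2, J_4, and [a], [b], [c] for (q; q^2)_oo, (-q; q^2)_oo,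
    (q^2; q^4)_oo. *)
Lemma Nq2_value x1 x2 x4 a b c : x1 != 0 -> x2 != 0 -> x4 != 0 ->
  x1 = a * x2 -> x2 = c * x4 -> a * b = c -> b = x2 ^+ 2 / (x1 * x4).
Proof.
move=> n1 n2 n4 e1 e2 e3.
have ab : a * b = x2 / x4 by rewrite e3 {1}e2 mulfK.
apply: (mulfI n1); rewrite [in LHS]e1 mulrAC ab.
by field; rewrite n1 n4.
Qed.

Lemma phi_value x1 x2 x4 : x1 != 0 -> x4 != 0 ->
  x2 ^+ 2 / (x1 * x4) * (x2 ^+ 2 / (x1 * x4)) * x2 = x2 ^+ 5 / (x1 ^+ 2 * x4 ^+ 2).
Proof. by move=> n1 n4; field; rewrite n1 n4. Qed.

Lemma psi_value x2 x4 : x2 != 0 ->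
  x4 / x2 * ((1 + 1) * (x4 / x2)) * x2 = 2 * (x4 ^+ 2 / x2).
Proof. by move=> n2; field. Qed.

End ThetaAlgebra.

Section ThetaValues.
Variable R : realType.
Local Notation C := (R[i]).
Variable q : C.
Hypotheses (q_lt1 : `|q| < 1) (q_neq0 : q != 0).

Lemma qpoch_inf_oppM (a : C) : a != 0 ->
  qpoch_inf a q * qpoch_inf (- a) q = qpoch_inf (a ^+ 2) (q ^+ 2).
Proof.
move=> a0.
have h := seq_cvgM (qpoch_cvg q_lt1 q_neq0 a0)
  (qpoch_cvg q_lt1 q_neq0 (_ : - a != 0)).
have a20 : a ^+ 2 != 0 by rewrite expf_neq0.
have q20 : q ^+ 2 != 0 by rewrite expf_neq0.
apply: seq_cvg_unique (h _) _; first by rewrite oppr_eq0.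
have := qpoch_cvg (norm_exprn_lt1 q_lt1 (isT : 0 < 2)%N) q20 a20.
congr seq_cvg; apply/funext => n; rewrite /qpoch -big_split/=.
by apply: eq_bigr => k _; rewrite exprAC; ring.
Qed.

Lemma etaJ_half m : (0 < m)%N ->
  etaJ q m = qpoch_inf (q ^+ m) (q ^+ (2 * m)) * etaJ q (2 * m).
Proof.
move=> m0; have qm : q ^+ m != 0 by rewrite expf_neq0.
rewrite [LHS]etaJE (qpoch_infM (norm_exprn_lt1 q_lt1 m0) qm qm (isT : 0 < 2)%N).
rewrite !big_ord_recr big_ord0 /= mul1r expr0 mulr1 expr1 -expr2 -exprM.
by rewrite mulnC -etaJE.
Qed.

Lemma qpoch_inf_Nq : qpoch_inf (- q) q = etaJ q 2 / etaJ q 1.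
Proof.
have e1 := etaJ_neq0 q_lt1 q_neq0 (isT : 0 < 1)%N.
have h : etaJ q 1 * qpoch_inf (- q) q = etaJ q 2 by rewrite !etaJE expr1 qpoch_inf_oppM.
exact: eq_divr e1 h.
Qed.

Lemma qpoch_inf_Nq2 : qpoch_inf (- q) (q ^+ 2) = etaJ q 2 ^+ 2 / (etaJ q 1 * etaJ q 4).
Proof.
have e1 := etaJ_neq0 q_lt1 q_neq0 (isT : 0 < 1)%N.
have e2 := etaJ_neq0 q_lt1 q_neq0 (isT : 0 < 2)%N.
have e4 := etaJ_neq0 q_lt1 q_neq0 (isT : 0 < 4)%N.
have h1 := etaJ_half (isT : 0 < 1)%N; have h2 := etaJ_half (isT : 0 < 2)%N.
rewrite expr1 muln1 in h1; rewrite (_ : 2 * 2 = 4)%N// in h2.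
have q20 : q ^+ 2 != 0 by rewrite expf_neq0.
have odd : qpoch_inf q (q ^+ 2) * qpoch_inf (- q) (q ^+ 2) = qpoch_inf (q ^+ 2) (q ^+ 4).
  have := norm_exprn_lt1 q_lt1 (isT : 0 < 2)%N => q21.
  apply: seq_cvg_unique (seq_cvgM (qpoch_cvg q21 q20 q_neq0) (qpoch_cvg q21 q20 (_ : - q != 0))) _.
    by rewrite oppr_eq0.
  have q40 : q ^+ 4 != 0 by rewrite expf_neq0.
  have := qpoch_cvg (norm_exprn_lt1 q_lt1 (isT : 0 < 4)%N) q40 q20.
  congr seq_cvg; apply/funext => n; rewrite /qpoch -big_split/=.
  apply: eq_bigr => k _; rewrite -!exprM (_ : 4 * k = 2 * k + 2 * k)%N ?exprD; last by lia.
  ring.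
exact: Nq2_value e1 e2 e4 h1 h2 odd.
Qed.

Lemma has_sum_phi :
  has_sum (fun d : int => q ^ (d * d)) (etaJ q 2 ^+ 5 / (etaJ q 1 ^+ 2 * etaJ q 4 ^+ 2)).
Proof.
have e1 := etaJ_neq0 q_lt1 q_neq0 (isT : 0 < 1)%N.
have e4 := etaJ_neq0 q_lt1 q_neq0 (isT : 0 < 4)%N.
have q20 : q ^+ 2 != 0 by rewrite expf_neq0.
have := jacobi_triple (norm_exprn_lt1 q_lt1 (isT : 0 < 2)%N) q20 q_neq0.
rewrite (_ : q ^+ 2 / q = q); last by rewrite expr2 mulfK.
rewrite qpoch_inf_Nq2 -etaJE => h.
rewrite -(phi_value _ e1 e4).
apply: eq_has_sum h => d; rewrite exprnP exprz_exp -expfzDr//; congr (_ ^ _); tri_lia.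
Qed.

(** Ramanujan's 2 psi(q^2). The triple product in base q^2 at z = q^2 contains (-1; q^2)_oo = 2
    (-q^2; q^2)_oo, which is the origin of the factor 2. *)
Lemma has_sum_psi :
  has_sum (fun d : int => q ^ (d * d + d)) (2 * (etaJ q 4 ^+ 2 / etaJ q 2)).
Proof.
have e2 := etaJ_neq0 q_lt1 q_neq0 (isT : 0 < 2)%N.
have q20 : q ^+ 2 != 0 by rewrite expf_neq0.
have q21 := norm_exprn_lt1 q_lt1 (isT : 0 < 2)%N.
have N : qpoch_inf (- q ^+ 2) (q ^+ 2) = etaJ q 4 / etaJ q 2.
  apply: (eq_divr e2); rewrite !etaJE.
  apply: seq_cvg_unique (seq_cvgM (qpoch_cvg q21 q20 q20) (qpoch_cvg q21 q20 (_ : - q ^+ 2 != 0))) _.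
    by rewrite oppr_eq0.
  have q40 : q ^+ 4 != 0 by rewrite expf_neq0.
  have := qpoch_cvg (norm_exprn_lt1 q_lt1 (isT : 0 < 4)%N) q40 q40.
  congr seq_cvg; apply/funext => n; rewrite /qpoch -big_split/=.
  apply: eq_bigr => k _; rewrite -!exprM (_ : 4 * k = 2 * k + 2 * k)%N ?exprD; last by lia.
  rewrite (_ : q ^+ 4 = q ^+ 2 * q ^+ 2); [ring|by rewrite -exprD].
have := jacobi_triple q21 q20 q20; rewrite divff//.
rewrite (qpoch_infS q21 q20 (_ : -1 != 0)) ?oppr_eq0 ?oner_eq0// opprK mulN1r N -etaJE => h.
rewrite -(psi_value _ e2).
apply: eq_has_sum h => d; rewrite exprnP !exprz_exp -expfzDr//; congr (_ ^ _); tri_lia.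
Qed.

(** On the left every even residue modulo 20 occurs once, which gives J_2, and the residue 0 twice
    more. This trades the product of thetas in Slater's 79 for a single theta in the denominator,
    and shows that theta to be nonzero. *)
Lemma thetaJ_merge : thetaJ q 2 10 * thetaJ q 6 20 * thetaJ q 4 20 = etaJ q 2 * etaJ q 20 ^+ 2.
Proof.
have q20 : q ^+ 2 != 0 by rewrite expf_neq0.
have qn m : q ^+ m != 0 by rewrite expf_neq0.
have q21 := norm_exprn_lt1 q_lt1 (isT : 0 < 2)%N.
pose G m := qpoch_inf (q ^+ m) (q ^+ 20).
have D m : qpoch_inf (q ^+ m) (q ^+ 10) = G m * G (m + 10)%N.
  rewrite (qpoch_infM (norm_exprn_lt1 q_lt1 (isT : 0 < 10)%N) (qn _) (qn _) (isT : 0 < 2)%N).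
  by rewrite !big_ord_recr big_ord0 /= mul1r expr0 mulr1 expr1 -exprD -exprM.
have T a b m : (a + b = m)%N -> thetaJ q a m =
    qpoch_inf (q ^+ a) (q ^+ m) * qpoch_inf (q ^+ b) (q ^+ m) * qpoch_inf (q ^+ m) (q ^+ m).
  by move=> <-; rewrite /thetaJ /qpoch_infs !big_cons big_nil addKn mulr1 mulrA.
have J2 : etaJ q 2 = G 2 * G 4 * G 6 * G 8 * G 10 * G 12 * G 14 * G 16 * G 18 * G 20.
  rewrite etaJE (qpoch_infM q21 q20 q20 (isT : 0 < 10)%N).
  by rewrite !big_ord_recr big_ord0 /= mul1r -!exprM -!exprD.
have J20 : etaJ q 20 = G 20 by rewrite etaJE.
rewrite (T 2 8 10)%N // (D 2%N) (D 8%N) (D 10%N).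
rewrite (T 6 14 20)%N // (T 4 16 20)%N // J2 J20 -!/(G _).
rewrite (_ : 2 + 10 = 12)%N // (_ : 8 + 10 = 18)%N // (_ : 10 + 10 = 20)%N //.
move: G {D J2 J20} => G; ring.
Qed.

Lemma thetaJ_4_20_neq0 : thetaJ q 4 20 != 0.
Proof.
have := mulf_neq0 (etaJ_neq0 q_lt1 q_neq0 (isT : 0 < 2)%N)
  (expf_neq0 2 (etaJ_neq0 q_lt1 q_neq0 (isT : 0 < 20)%N)).
by rewrite -thetaJ_merge mulf_eq0 negb_or => /andP[].
Qed.

Lemma etaJ_sqr m : etaJ (q ^+ 2) m = etaJ q (2 * m).
Proof. by rewrite !etaJE -exprM. Qed.

Lemma thetaJ_sqr a m : thetaJ (q ^+ 2) a m = thetaJ q (2 * a) (2 * m).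
Proof. by rewrite /thetaJ -!exprM mulnBr. Qed.

End ThetaValues.

(** * The identities *)

Lemma double_halfD (k : nat) : ((k%:Z ^+ 2 + k%:Z) %/ 2)%Z = tri k + k%:Z.
Proof. have := double_tri k; rewrite expr2; lia. Qed.

Lemma double_halfB (k : nat) : ((k%:Z ^+ 2 - k%:Z) %/ 2)%Z = tri k.
Proof. have := double_tri k; rewrite expr2; lia. Qed.

Section FinalAlgebra.
Variable F : fieldType.

(** The left side has the shape delivered by the triple sum: prefactor, phi times an even Slater
    sum, then [r] = y/w times psi times an odd one. The infinite products are abstracted to
    variables. *)
Lemma value_phi_psi r a b c d (j1 j2 j4 j20 : F) : j1 != 0 -> j2 != 0 -> j4 != 0 -> j20 != 0 ->
  j2 / j1 / j1 * (j2 ^+ 5 / (j1 ^+ 2 * j4 ^+ 2) * (a * b / (j20 * j1)) +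
    r * (2 * (j4 ^+ 2 / j2) * (c * d / (j20 * j1)))) =
  j2 ^+ 6 * a * b / (j1 ^+ 5 * j4 ^+ 2 * j20) + 2 * r * (j4 ^+ 2 * c * d / (j1 ^+ 3 * j20)).
Proof. by move=> n1 n2 n4 n20; field; rewrite n1 n2 n4 n20. Qed.

Lemma value_psi_phi a b c d t (j1 j2 j4 j20 : F) :
  j1 != 0 -> j2 != 0 -> j4 != 0 -> j20 != 0 -> t != 0 -> a * b * t = j2 * j20 ^+ 2 ->
  j2 / j1 / j1 * (2 * (j4 ^+ 2 / j2) * (a * b / (j20 * j1)) +
    j2 ^+ 5 / (j1 ^+ 2 * j4 ^+ 2) * (c * d / (j20 * j1))) =
  2 * (j2 * j4 ^+ 2 * j20 / (j1 ^+ 3 * t)) + j2 ^+ 6 * c * d / (j1 ^+ 5 * j4 ^+ 2 * j20).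
Proof.
move=> n1 n2 n4 n20 nt h.
rewrite (_ : a * b = j2 * j20 ^+ 2 / t); last by rewrite -h mulfK.
by field; rewrite n1 n2 n4 n20 nt.
Qed.

Lemma value_psi_phi' a b c d t (j1 j2 j4 j20 : F) :
  j1 != 0 -> j2 != 0 -> j4 != 0 -> j20 != 0 -> t != 0 -> a * b * t = j2 * j20 ^+ 2 ->
  j2 / j1 / j1 * (2 * (j4 ^+ 2 / j2) * (a * b / (j20 * j1)) +
    1 * (j2 ^+ 5 / (j1 ^+ 2 * j4 ^+ 2) * (c * d / (j20 * j1)))) =
  2 * (j2 * j4 ^+ 2 * j20 / (j1 ^+ 3 * t)) + j2 ^+ 6 * c * d / (j1 ^+ 5 * j4 ^+ 2 * j20).
Proof. by rewrite mul1r; exact: value_psi_phi. Qed.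

Lemma value_half_phi_psi q a b c d t (j1 j2 j4 j8 j40 : F) :
  j1 != 0 -> j2 != 0 -> j4 != 0 -> j8 != 0 -> j40 != 0 -> t != 0 ->
  a * b * t = j4 * j40 ^+ 2 ->
  j2 ^+ 2 / (j1 * j4) / j2 * (j4 ^+ 5 / (j2 ^+ 2 * j8 ^+ 2) * (a * b / (j40 * j2)) +
    q * (2 * (j8 ^+ 2 / j4) * (c * d / (j40 * j2)))) =
  j4 ^+ 5 * j40 / (j1 * j2 ^+ 2 * j8 ^+ 2 * t) + 2 * q * (j8 ^+ 2 * c * d / (j1 * j4 ^+ 2 * j40)).
Proof.
move=> n1 n2 n4 n8 n40 nt h.
rewrite (_ : a * b = j4 * j40 ^+ 2 / t); last by rewrite -h mulfK.
by field; rewrite n1 n2 n4 n8 n40 nt.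
Qed.

(** Here y/w = q^3, and the inverse of q^2 comes from completing the square in the phi series of
    base q^2. *)
Lemma value_half_psi_phi q a b c d (j1 j2 j4 j8 j40 : F) : q != 0 ->
  j1 != 0 -> j2 != 0 -> j4 != 0 -> j8 != 0 -> j40 != 0 ->
  j2 ^+ 2 / (j1 * j4) / j2 * (2 * (j8 ^+ 2 / j4) * (a * b / (j40 * j2)) +
    q ^+ 3 * ((q ^+ 2)^-1 * (j4 ^+ 5 / (j2 ^+ 2 * j8 ^+ 2)) * (c * d / (j40 * j2)))) =
  2 * (j8 ^+ 2 * a * b / (j1 * j4 ^+ 2 * j40)) +
  q * (j4 ^+ 4 * c * d / (j1 * j2 ^+ 2 * j8 ^+ 2 * j40)).
Proof. by move=> n0 n1 n2 n4 n8 n40; field; rewrite n0 n1 n2 n4 n8 n40. Qed.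

Lemma value_psi_phi_twice q a b c d t (j1 j2 j4 j20 : F) : q != 0 ->
  j1 != 0 -> j2 != 0 -> j4 != 0 -> j20 != 0 -> t != 0 -> a * b * t = j2 * j20 ^+ 2 ->
  2 * (j2 / j1) / j1 * (2 * (j4 ^+ 2 / j2) * (a * b / (j20 * j1)) +
    q * (q^-1 * (j2 ^+ 5 / (j1 ^+ 2 * j4 ^+ 2)) * (c * d / (j20 * j1)))) =
  4 * (j2 * j4 ^+ 2 * j20 / (j1 ^+ 3 * t)) +
  2 * (j2 ^+ 6 * c * d / (j1 ^+ 5 * j4 ^+ 2 * j20)).
Proof.
move=> n0 n1 n2 n4 n20 nt h.
rewrite (_ : 4 * _ = 2 * (2 * (j2 * j4 ^+ 2 * j20 / (j1 ^+ 3 * t)))); last by ring.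
rewrite -[RHS]mulrDr -(value_psi_phi c d n1 n2 n4 n20 nt h) -[q^-1 * _ * _]mulrA mulVKf//.
by ring.
Qed.

Lemma value_phi_psi_twice q a b c d (j1 j2 j4 j20 : F) : q != 0 ->
  j1 != 0 -> j2 != 0 -> j4 != 0 -> j20 != 0 ->
  2 * (j2 / j1) / j1 *
    (q^-1 * (j2 ^+ 5 / (j1 ^+ 2 * j4 ^+ 2)) * (a * b / (j20 * j1)) +
     q ^ 2 * (q ^ (-2) * (2 * (j4 ^+ 2 / j2)) * (c * d / (j20 * j1)))) =
  2 * q^-1 * (j2 ^+ 6 * a * b / (j1 ^+ 5 * j4 ^+ 2 * j20)) +
  4 * (j4 ^+ 2 * c * d / (j1 ^+ 3 * j20)).
Proof.
move=> n0 n1 n2 n4 n20.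
rewrite [q ^ 2 * _]mulrA [q ^ 2 * _]mulrA -expfzDr// subrr expr0z mul1r.
by field; rewrite n0 n1 n2 n4 n20.
Qed.

End FinalAlgebra.

Section Identities.
Variable R : realType.
Local Notation C := (R[i]).
Variable q : C.
Hypotheses (q_lt1 : `|q| < 1) (q_neq0 : q != 0).

(** Specialisation to Q = q^m, y = q^b, w = q^c, so that an identity is determined by (m, b, c) and
    y^2/w becomes q^(2b-c). The exponent [e] is separate so that it can be matched in the form in
    which each identity is written. *)
Lemma has_sum3_triple (m : nat) (b c : int) (e : nat -> nat -> nat -> int) Q A B D E P r V :
  (0 < m)%N -> Q = q ^+ m ->
  (forall i j k : nat, e i j k =
    m%:Z * (i%:Z * i%:Z + j%:Z * j%:Z + tri k - i%:Z * j%:Z - j%:Z * k%:Z) + b * k%:Z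
    + c * (i%:Z - j%:Z)) ->
  has_sum (fun d : int => Q ^ (d * d) * q ^ (- (c * d))) A ->
  has_sum (fun n : int => Q ^ (n * n - n) * q ^ ((2 * b - c) * n) * inv_qpoch Q (2 * n)) B ->
  has_sum (fun d : int => Q ^ (d * d + d) * q ^ (- (c * d))) D ->
  has_sum (fun n : int => Q ^ (n * n) * q ^ ((2 * b - c) * n) * inv_qpoch Q (2 * n + 1)) E ->
  qpoch_inf (- q ^ b) Q / qpoch_inf Q Q = P -> q ^ (b - c) = r ->
  P * (A * B + r * (D * E)) = V ->
  has_sum3 (fun i j k => q ^ (e i j k) / (qpoch Q Q i * qpoch Q Q j * qpoch Q Q k)) V.
Proof.
move=> m0 QE eE hA hB hD hE <- <- <-; apply: has_sum3_has_sum.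
have Q1 : `|Q| < 1 by rewrite QE norm_exprn_lt1.
have Q0 : Q != 0 by rewrite QE expf_neq0.
have qc (n : int) : q ^ n != 0 by exact: expfz_neq0.
have wE (d : int) : (q ^ c) ^ (- d) = q ^ (- (c * d)).
  by rewrite exprz_exp; congr (_ ^ _); ring.
have ywE (n : int) : (q ^ b * q ^ b / q ^ c) ^ n = q ^ ((2 * b - c) * n).
  by rewrite invr_expz -!expfzDr// exprz_exp; congr (_ ^ _); ring.
rewrite (_ : q ^ (b - c) = q ^ b / q ^ c); last by rewrite invr_expz -expfzDr.
have hs : has_sum (fun t : int * int * int => triple_term Q (q ^ b) (q ^ c) t.1.1 t.1.2 t.2)
    (qpoch_inf (- q ^ b) Q / qpoch_inf Q Q * (A * B + q ^ b / q ^ c * (D * E))).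
  apply: (triple_sum Q1 Q0 (qc b) (qc c)).
  - by apply: eq_has_sum hA => d; rewrite wE.
  - by apply: eq_has_sum hB => d; rewrite ywE.
  - by apply: eq_has_sum hD => d; rewrite wE.
  - by apply: eq_has_sum hE => d; rewrite ywE.
have hi : injective (fun t : nat * nat * nat => (Posz t.1.1, Posz t.1.2, Posz t.2)).
  by move=> [[? ?] ?] [[? ?] ?] /= [-> -> ->].
have h0 (y : int * int * int) :
    (forall x : nat * nat * nat, (Posz x.1.1, Posz x.1.2, Posz x.2) <> y) ->
    triple_term Q (q ^ b) (q ^ c) y.1.1 y.1.2 y.2 = 0.
  case: y => [[[i|i] [j|j]] [k|k]] h /=; rewrite /triple_term /= ?mulr0 ?mul0r ?mulr0 ?mul0r//.
  by case: (h (i, j, k)).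
apply: eq_has_sum (iffLR (has_sum_inj _ hi h0) hs) => -[[i j] k] /=.
rewrite /triple_term/= eE QE !exprnP !exprz_exp.
rewrite [q ^ (_ + c * _)]expfzDr// [q ^ (_ + b * _)]expfzDr//.
by rewrite !invfM; ring.
Qed.

End Identities.

Section ShiftedPhi.
Variable R : realType.
Variable q : R[i].
Hypotheses (q_lt1 : `|q| < 1) (q_neq0 : q != 0).

Lemma has_sum_phi2 : has_sum (fun d : int => q ^ (d * d + 2 * d))
  (q^-1 * (etaJ q 2 ^+ 5 / (etaJ q 1 ^+ 2 * etaJ q 4 ^+ 2))).
Proof.
apply: eq_has_sum (has_sumZ q^-1 (has_sum_shift 1 (has_sum_phi q_lt1 q_neq0))) => d.
by rewrite /= -[q^-1]/(q ^ -1) -expfzDr//; congr (_ ^ _); ring.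
Qed.

End ShiftedPhi.

Section Identities.
Variable R : realType.
Local Notation C := (R[i]).
Variable q : C.
Hypotheses (q_lt1 : `|q| < 1) (q_neq0 : q != 0).

Let q2_lt1 : `|q ^+ 2| < 1. Proof. exact: norm_exprn_lt1. Qed.
Let q2_neq0 : q ^+ 2 != 0. Proof. by rewrite expf_neq0. Qed.
Let q_expr1 : q = q ^+ 1. Proof. by rewrite expr1. Qed.
Let e1 := etaJ_neq0 q_lt1 q_neq0 (isT : 0 < 1)%N.
Let e2 := etaJ_neq0 q_lt1 q_neq0 (isT : 0 < 2)%N.
Let e4 := etaJ_neq0 q_lt1 q_neq0 (isT : 0 < 4)%N.
Let e8 := etaJ_neq0 q_lt1 q_neq0 (isT : 0 < 8)%N.
Let e20 := etaJ_neq0 q_lt1 q_neq0 (isT : 0 < 20)%N.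
Let e40 := etaJ_neq0 q_lt1 q_neq0 (isT : 0 < 40)%N.
Local Notation qD := (fun m n => @expfzDr _ q m n q_neq0).

Lemma qpoch_inf_N1 : qpoch_inf (-1) q = 2 * (etaJ q 2 / etaJ q 1).
Proof. by rewrite qpoch_infS ?oppr_eq0 ?oner_eq0// opprK mulN1r qpoch_inf_Nq. Qed.

Lemma qpoch_inf_q : qpoch_inf q q = etaJ q 1.
Proof. by rewrite etaJE expr1. Qed.


Lemma expr2z_exprz (n : int) : (q ^+ 2) ^ n = q ^ (2 * n).
Proof. by rewrite exprnP exprz_exp. Qed.

(** d^2 + 3d = (d + 1)^2 + (d + 1) - 2, so this is a shifted psi series. *)
Lemma has_sum_psi3 : has_sum (fun d : int => q ^ (d * d + 3 * d))
  (q ^ (-2) * (2 * (etaJ q 4 ^+ 2 / etaJ q 2))).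
Proof.
apply: eq_has_sum (has_sumZ (q ^ (-2)) (has_sum_shift 1 (has_sum_psi q_lt1 q_neq0))) => d.
by rewrite /= -qD; congr (_ ^ _); ring.
Qed.

Lemma identity2 : has_sum3
    (fun i j k : nat =>
       q ^ (i%:Z ^+ 2 + j%:Z ^+ 2 + ((k%:Z ^+ 2 + k%:Z) %/ 2)%Z
            - i%:Z * j%:Z - j%:Z * k%:Z)
       / (qpoch q q i * qpoch q q j * qpoch q q k))
    (etaJ q 2 ^+ 6 * thetaJ q 1 10 * thetaJ q 8 20
       / (etaJ q 1 ^+ 5 * etaJ q 4 ^+ 2 * etaJ q 20)
     + 2 * q * (etaJ q 4 ^+ 2 * thetaJ q 4 10 * thetaJ q 2 20
       / (etaJ q 1 ^+ 3 * etaJ q 20))).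
Proof.
apply: (has_sum3_triple q_lt1 q_neq0 (m := 1) (b := 1) (c := 0)
  (e := fun i j k => (i%:Z ^+ 2 + j%:Z ^+ 2 + ((k%:Z ^+ 2 + k%:Z) %/ 2)%Z
            - i%:Z * j%:Z - j%:Z * k%:Z))
  isT q_expr1 _ _ _ _ _ _ _ (value_phi_psi q _ _ _ _ e1 e2 e4 e20)).
- by move=> i j k; rewrite double_halfD; ring.
- apply: eq_has_sum (has_sum_phi q_lt1 q_neq0) => d.
  by rewrite -qD; congr (_ ^ _); ring.
- apply: eq_has_sum (slater99 q_lt1 q_neq0) => n.
  by rewrite -qD; congr (_ ^ _ * _); ring.
- apply: eq_has_sum (has_sum_psi q_lt1 q_neq0) => d.
  by rewrite -qD; congr (_ ^ _); ring.
- apply: eq_has_sum (slater96 q_lt1 q_neq0) => n.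
  by rewrite -qD; congr (_ ^ _ * _); ring.
- by rewrite expr1z qpoch_inf_q qpoch_inf_Nq.
- by rewrite subr0 expr1z.
Qed.

Lemma identity3 : has_sum3
    (fun i j k : nat =>
       q ^ (i%:Z ^+ 2 + j%:Z ^+ 2 + ((k%:Z ^+ 2 + k%:Z) %/ 2)%Z
            - i%:Z * j%:Z - j%:Z * k%:Z + i%:Z - j%:Z)
       / (qpoch q q i * qpoch q q j * qpoch q q k))
    (2 * (etaJ q 2 * etaJ q 4 ^+ 2 * etaJ q 20
       / (etaJ q 1 ^+ 3 * thetaJ q 4 20))
     + etaJ q 2 ^+ 6 * thetaJ q 3 10 * thetaJ q 4 20
       / (etaJ q 1 ^+ 5 * etaJ q 4 ^+ 2 * etaJ q 20)).
Proof.
apply: (has_sum3_triple q_lt1 q_neq0 (m := 1) (b := 1) (c := 1)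
  (e := fun i j k => (i%:Z ^+ 2 + j%:Z ^+ 2 + ((k%:Z ^+ 2 + k%:Z) %/ 2)%Z
            - i%:Z * j%:Z - j%:Z * k%:Z + i%:Z - j%:Z))
  isT q_expr1 _ _ _ _ _ _ _ (value_psi_phi' _ _ e1 e2 e4 e20 (thetaJ_4_20_neq0 q_lt1 q_neq0) (thetaJ_merge q_lt1 q_neq0))).
- by move=> i j k; rewrite double_halfD; ring.
- apply: eq_has_sum (has_sum_opp (has_sum_psi q_lt1 q_neq0)) => d.
  by rewrite -qD; congr (_ ^ _); ring.
- apply: eq_has_sum (slater79 q_lt1 q_neq0) => n.
  by rewrite -qD; congr (_ ^ _ * _); ring.
- apply: eq_has_sum (has_sum_phi q_lt1 q_neq0) => d.
  by rewrite -qD; congr (_ ^ _); ring.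
- apply: eq_has_sum (slater94 q_lt1 q_neq0) => n.
  by rewrite -qD; congr (_ ^ _ * _); ring.
- by rewrite expr1z qpoch_inf_q qpoch_inf_Nq.
- by rewrite subrr expr0z.
Qed.

Lemma identity5 : has_sum3
    (fun i j k : nat =>
       q ^ (i%:Z ^+ 2 + j%:Z ^+ 2 + ((k%:Z ^+ 2 - k%:Z) %/ 2)%Z
            - i%:Z * j%:Z - j%:Z * k%:Z - i%:Z + j%:Z)
       / (qpoch q q i * qpoch q q j * qpoch q q k))
    (4 * (etaJ q 2 * etaJ q 4 ^+ 2 * etaJ q 20
       / (etaJ q 1 ^+ 3 * thetaJ q 4 20))
     + 2 * (etaJ q 2 ^+ 6 * thetaJ q 3 10 * thetaJ q 4 20
       / (etaJ q 1 ^+ 5 * etaJ q 4 ^+ 2 * etaJ q 20))).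
Proof.
apply: (has_sum3_triple q_lt1 q_neq0 (m := 1) (b := 0) (c := (-1)%Z)
  (e := fun i j k => (i%:Z ^+ 2 + j%:Z ^+ 2 + ((k%:Z ^+ 2 - k%:Z) %/ 2)%Z
            - i%:Z * j%:Z - j%:Z * k%:Z - i%:Z + j%:Z))
  isT q_expr1 _ _ _ _ _ _ _ (value_psi_phi_twice _ _ q_neq0 e1 e2 e4 e20 (thetaJ_4_20_neq0 q_lt1 q_neq0) (thetaJ_merge q_lt1 q_neq0))).
- by move=> i j k; rewrite double_halfB; ring.
- apply: eq_has_sum (has_sum_psi q_lt1 q_neq0) => d.
  by rewrite -qD; congr (_ ^ _); ring.
- apply: eq_has_sum (slater79 q_lt1 q_neq0) => n.
  by rewrite -qD; congr (_ ^ _ * _); ring.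
- apply: eq_has_sum (has_sum_phi2 q_lt1 q_neq0) => d.
  by rewrite -qD; congr (_ ^ _); ring.
- apply: eq_has_sum (slater94 q_lt1 q_neq0) => n.
  by rewrite -qD; congr (_ ^ _ * _); ring.
- by rewrite expr0z qpoch_inf_q qpoch_inf_N1.
- by rewrite (_ : _ - _ = 1)// expr1z.
Qed.

Lemma identity6 : has_sum3
    (fun i j k : nat =>
       q ^ (i%:Z ^+ 2 + j%:Z ^+ 2 + ((k%:Z ^+ 2 - k%:Z) %/ 2)%Z
            - i%:Z * j%:Z - j%:Z * k%:Z - 2 * i%:Z + 2 * j%:Z)
       / (qpoch q q i * qpoch q q j * qpoch q q k))
    (2 * q^-1 * (etaJ q 2 ^+ 6 * thetaJ q 1 10 * thetaJ q 8 20
       / (etaJ q 1 ^+ 5 * etaJ q 4 ^+ 2 * etaJ q 20))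
     + 4 * (etaJ q 4 ^+ 2 * thetaJ q 4 10 * thetaJ q 2 20
       / (etaJ q 1 ^+ 3 * etaJ q 20))).
Proof.
apply: (has_sum3_triple q_lt1 q_neq0 (m := 1) (b := 0) (c := (-2)%Z)
  (e := fun i j k => (i%:Z ^+ 2 + j%:Z ^+ 2 + ((k%:Z ^+ 2 - k%:Z) %/ 2)%Z
            - i%:Z * j%:Z - j%:Z * k%:Z - 2 * i%:Z + 2 * j%:Z))
  isT q_expr1 _ _ _ _ _ _ _ (value_phi_psi_twice _ _ _ _ q_neq0 e1 e2 e4 e20)).
- by move=> i j k; rewrite double_halfB; ring.
- apply: eq_has_sum (has_sum_phi2 q_lt1 q_neq0) => d.
  by rewrite -qD; congr (_ ^ _); ring.
- apply: eq_has_sum (slater99 q_lt1 q_neq0) => n.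
  by rewrite -qD; congr (_ ^ _ * _); ring.
- apply: eq_has_sum (has_sum_psi3) => d.
  by rewrite -qD; congr (_ ^ _); ring.
- apply: eq_has_sum (slater96 q_lt1 q_neq0) => n.
  by rewrite -qD; congr (_ ^ _ * _); ring.
- by rewrite expr0z qpoch_inf_q qpoch_inf_N1.
- by [].
Qed.

Lemma identity1 : has_sum3
    (fun i j k : nat =>
       q ^ (2 * i%:Z ^+ 2 + 2 * j%:Z ^+ 2 + k%:Z ^+ 2
            - 2 * i%:Z * j%:Z - 2 * j%:Z * k%:Z)
       / (qpoch (q ^+ 2) (q ^+ 2) i * qpoch (q ^+ 2) (q ^+ 2) j
          * qpoch (q ^+ 2) (q ^+ 2) k))
    (etaJ q 4 ^+ 5 * etaJ q 40
       / (etaJ q 1 * etaJ q 2 ^+ 2 * etaJ q 8 ^+ 2 * thetaJ q 8 40)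
     + 2 * q * (etaJ q 8 ^+ 2 * thetaJ q 6 20 * thetaJ q 8 40
       / (etaJ q 1 * etaJ q 4 ^+ 2 * etaJ q 40))).
Proof.
have phi := has_sum_phi q2_lt1 q2_neq0; have psi := has_sum_psi q2_lt1 q2_neq0.
have s79 := slater79 q2_lt1 q2_neq0; have s94 := slater94 q2_lt1 q2_neq0.
have t := thetaJ_4_20_neq0 q2_lt1 q2_neq0; have tm := thetaJ_merge q2_lt1 q2_neq0.
rewrite !etaJ_sqr in phi; rewrite !etaJ_sqr in psi; rewrite thetaJ_sqr in t.
rewrite !etaJ_sqr !thetaJ_sqr in s79; rewrite !etaJ_sqr !thetaJ_sqr in s94.
rewrite !etaJ_sqr !thetaJ_sqr in tm.
apply: (has_sum3_triple q_lt1 q_neq0 (m := 2) (b := 1) (c := 0)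
  (e := fun i j k => (2 * i%:Z ^+ 2 + 2 * j%:Z ^+ 2 + k%:Z ^+ 2
            - 2 * i%:Z * j%:Z - 2 * j%:Z * k%:Z))
  isT erefl _ _ _ _ _ _ _ (value_half_phi_psi q _ _ e1 e2 e4 e8 e40 t tm)).
- move=> i j k; rewrite (_ : k%:Z ^+ 2 = 2 * tri k + k%:Z); first by ring.
  by rewrite double_tri; ring.
- apply: eq_has_sum phi => d.
  by rewrite !expr2z_exprz -qD; congr (_ ^ _); ring.
- apply: eq_has_sum s79 => d.
  by rewrite !expr2z_exprz -qD; congr (_ ^ _ * _); ring.
- apply: eq_has_sum psi => d.
  by rewrite !expr2z_exprz -qD; congr (_ ^ _); ring.
- apply: eq_has_sum s94 => d.
  by rewrite !expr2z_exprz -qD; congr (_ ^ _ * _); ring.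
- by rewrite expr1z qpoch_inf_Nq2// -etaJE.
- by rewrite subr0 expr1z.
Qed.

Lemma identity4 : has_sum3
    (fun i j k : nat =>
       q ^ (2 * i%:Z ^+ 2 + 2 * j%:Z ^+ 2 + k%:Z ^+ 2
            - 2 * i%:Z * j%:Z - 2 * j%:Z * k%:Z - 2 * i%:Z + 2 * j%:Z)
       / (qpoch (q ^+ 2) (q ^+ 2) i * qpoch (q ^+ 2) (q ^+ 2) j
          * qpoch (q ^+ 2) (q ^+ 2) k))
    (2 * (etaJ q 8 ^+ 2 * thetaJ q 2 20 * thetaJ q 16 40
       / (etaJ q 1 * etaJ q 4 ^+ 2 * etaJ q 40))
     + q * (etaJ q 4 ^+ 4 * thetaJ q 8 20 * thetaJ q 4 40
       / (etaJ q 1 * etaJ q 2 ^+ 2 * etaJ q 8 ^+ 2 * etaJ q 40))).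
Proof.
have psi := has_sum_psi q2_lt1 q2_neq0; have phi := has_sum_phi2 q2_lt1 q2_neq0.
have s99 := slater99 q2_lt1 q2_neq0; have s96 := slater96 q2_lt1 q2_neq0.
rewrite !etaJ_sqr in phi; rewrite !etaJ_sqr in psi.
rewrite !etaJ_sqr !thetaJ_sqr in s99; rewrite !etaJ_sqr !thetaJ_sqr in s96.
apply: (has_sum3_triple q_lt1 q_neq0 (m := 2) (b := 1) (c := (-2)%Z)
  (e := fun i j k => (2 * i%:Z ^+ 2 + 2 * j%:Z ^+ 2 + k%:Z ^+ 2
            - 2 * i%:Z * j%:Z - 2 * j%:Z * k%:Z - 2 * i%:Z + 2 * j%:Z))
  isT erefl _ _ _ _ _ _ _ (value_half_psi_phi _ _ _ _ q_neq0 e1 e2 e4 e8 e40)).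
- move=> i j k; rewrite (_ : k%:Z ^+ 2 = 2 * tri k + k%:Z); first by ring.
  by rewrite double_tri; ring.
- apply: eq_has_sum psi => d.
  by rewrite !expr2z_exprz -qD; congr (_ ^ _); ring.
- apply: eq_has_sum s99 => d.
  by rewrite !expr2z_exprz -qD; congr (_ ^ _ * _); ring.
- apply: eq_has_sum phi => d.
  by rewrite !expr2z_exprz -qD; congr (_ ^ _); ring.
- apply: eq_has_sum s96 => d.
  by rewrite !expr2z_exprz -qD; congr (_ ^ _ * _); ring.
- by rewrite expr1z qpoch_inf_Nq2// -etaJE.
- by [].
Qed.

End Identities.

(** * The case q = 0 *)

Section AtZero.
Variable R : realType.
Local Notation C := (R[i]).

Lemma qpoch00 n : qpoch (0 : C) 0 n = 1.
Proof. by rewrite /qpoch big1// => k _; rewrite mul0r subr0. Qed.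

Lemma qpoch_inf00 : qpoch_inf (0 : C) 0 = 1.
Proof.
apply: (@seq_cvg_lim _ (qpoch 0 0)); rewrite (_ : qpoch 0 0 = fun=> 1).
  exact: seq_cvg_cst.
by apply/funext => n; rewrite qpoch00.
Qed.

Lemma etaJ0 m : etaJ (0 : C) m.+1 = 1.
Proof. by rewrite etaJE expr0n qpoch_inf00. Qed.

(** Writing m as a sum of two successors encodes 0 < a < m, so that every power of 0 in the product
    vanishes. *)
Lemma thetaJ0 a b m : (a.+1 + b.+1)%N = m -> thetaJ (0 : C) a.+1 m = 1.
Proof.
move=> <-; rewrite /thetaJ /qpoch_infs !big_cons big_nil addKn !expr0n.
by rewrite qpoch_inf00 !mulr1.
Qed.

(** An integer power of 0 is 1 at exponent 0 and 0 elsewhere, including negative exponents, where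
    the inverse of 0 is 0 by convention. *)
Lemma has_sum3_at0 (e : nat -> nat -> nat -> int) (P : nat -> C) (l : seq (nat * nat * nat)) S :
  (forall n, P n = 1) -> uniq l ->
  (forall i j k, e i j k = 0 -> (i, j, k) \in l) ->
  (forall t, t \in l -> e t.1.1 t.1.2 t.2 = 0) -> S = (size l)%:R ->
  has_sum3 (fun i j k => 0 ^ (e i j k) / (P i * P j * P k)) S.
Proof.
move=> P1 ul le el ->; apply: has_sum3_has_sum.
set f := fun t : nat * nat * nat => _.
have fE t : f t = (e t.1.1 t.1.2 t.2 == 0)%:R by rewrite /f !P1 !mulr1 invr1 mulr1 exp0rz.
have -> : (size l)%:R = fsum f [fset t | t in l].
  rewrite /fsum big_imfset//= undup_id// big_seq.
  under eq_bigr => t tl do rewrite fE el// eqxx.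
  by rewrite -big_seq big_const_seq count_predT iter_addr addr0.
apply: has_sum_finite => -[[i j] k]; rewrite fE !inE/= => h.
case: eqP => // /le tl; case/negP: h; exact: tl.
Qed.

End AtZero.

#[global] Opaque thetaJ.

Lemma sqr_le1 (x : int) : x * x <= 1 -> [|| x == -1, x == 0 | x == 1].
Proof. by move=> h; have : -1 <= x <= 1 by [nia]; lia. Qed.

Lemma zeros1 (i j k : nat) :
  2 * i%:Z ^+ 2 + 2 * j%:Z ^+ 2 + k%:Z ^+ 2 - 2 * i%:Z * j%:Z - 2 * j%:Z * k%:Z = 0 ->
  (i, j, k) \in [:: (0, 0, 0)]%N.
Proof.
rewrite !expr2 => h.
(* The exponent is the sum of these three squares. *)
have ha := sqr_ge0 i%:Z; have hb := sqr_ge0 (j%:Z - i%:Z); have hc := sqr_ge0 (k%:Z - j%:Z).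
rewrite !expr2 in ha hb hc.
have i0 : i = 0%N by nia.
have j0 : j = 0%N by subst i; nia.
have k0 : k = 0%N by subst i j; nia.
by rewrite i0 j0 k0.
Qed.

Lemma zeros2 (i j k : nat) :
  i%:Z ^+ 2 + j%:Z ^+ 2 + ((k%:Z ^+ 2 + k%:Z) %/ 2)%Z - i%:Z * j%:Z - j%:Z * k%:Z = 0 ->
  (i, j, k) \in [:: (0, 0, 0)]%N.
Proof.
rewrite double_halfD; have := double_tri k; move: (tri k) => t ht; rewrite !expr2 => h.
have ha := sqr_ge0 i%:Z; have hb := sqr_ge0 (j%:Z - i%:Z); have hc := sqr_ge0 (k%:Z - j%:Z).
rewrite !expr2 in ha hb hc.
have k0 : k = 0%N by lia.
have i0 : i = 0%N by nia.
have j0 : j = 0%N by subst i k; nia.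
by rewrite i0 j0 k0.
Qed.

Lemma zeros3 (i j k : nat) :
  i%:Z ^+ 2 + j%:Z ^+ 2 + ((k%:Z ^+ 2 + k%:Z) %/ 2)%Z - i%:Z * j%:Z - j%:Z * k%:Z
    + i%:Z - j%:Z = 0 ->
  (i, j, k) \in [:: (0, 0, 0); (0, 1, 0); (0, 1, 1)]%N.
Proof.
rewrite double_halfD; have := double_tri k; move: (tri k) => t ht; rewrite !expr2 => h.
(* Twice the exponent is the sum of these three squares plus k - 1, so at a zero each square and k
   are at most 1. *)
have ha := sqr_ge0 i%:Z; have hb := sqr_ge0 (j%:Z - i%:Z - 1); have hc := sqr_ge0 (k%:Z - j%:Z).
rewrite !expr2 in ha hb hc.
have {ha} /sqr_le1 a1 : i%:Z * i%:Z <= 1 by lia.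
have /sqr_le1 b1 : (j%:Z - i%:Z - 1) * (j%:Z - i%:Z - 1) <= 1 by lia.
have k1 : (k <= 1)%N by lia.
case: i a1 b1 h hb hc => [|[|i]] // _ b1 h hb hc; last by lia.
have j2 : (j <= 2)%N by lia.
by case: j j2 b1 h hb hc => [|[|[|j]]] // _ _ h hb hc; case: k k1 ht h hc {hb} => [|[|k]] // _ ht h hc; lia.
Qed.

Lemma zeros4 (i j k : nat) :
  2 * i%:Z ^+ 2 + 2 * j%:Z ^+ 2 + k%:Z ^+ 2 - 2 * i%:Z * j%:Z - 2 * j%:Z * k%:Z
    - 2 * i%:Z + 2 * j%:Z = 0 ->
  (i, j, k) \in [:: (0, 0, 0); (1, 0, 0)]%N.
Proof.
rewrite !expr2 => h.
(* The exponent is the sum of these three squares minus 1. *)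
have ha := sqr_ge0 i%:Z; have hb := sqr_ge0 (j%:Z - i%:Z + 1); have hc := sqr_ge0 (k%:Z - j%:Z).
rewrite !expr2 in ha hb hc.
have {ha} /sqr_le1 a1 : i%:Z * i%:Z <= 1 by lia.
have /sqr_le1 b1 : (j%:Z - i%:Z + 1) * (j%:Z - i%:Z + 1) <= 1 by lia.
have /sqr_le1 c1 : (k%:Z - j%:Z) * (k%:Z - j%:Z) <= 1 by lia.
have k2 : (k <= 2)%N by lia.
case: i a1 b1 h hb hc => [|[|i]] // _ b1 h hb hc.
all: have j1 : (j <= 1)%N by lia.
all: by case: j j1 b1 c1 h hb hc => [|[|j]] // _ _ c1 h hb hc;
  case: k k2 c1 h hc {hb} => [|[|[|k]]] // _ _ h hc; lia.
Qed.

Lemma zeros5 (i j k : nat) :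
  i%:Z ^+ 2 + j%:Z ^+ 2 + ((k%:Z ^+ 2 - k%:Z) %/ 2)%Z - i%:Z * j%:Z - j%:Z * k%:Z
    - i%:Z + j%:Z = 0 ->
  (i, j, k) \in [:: (0, 0, 0); (1, 0, 0); (0, 0, 1); (1, 0, 1); (1, 1, 1); (1, 1, 2)]%N.
Proof.
rewrite double_halfB; have := double_tri k; move: (tri k) => t ht; rewrite !expr2 => h.
(* Twice the exponent is the sum of x^2 - x over x = i, j - i + 1, k - j, so at a zero each x is 0
   or 1. Of the eight cases the two with i = 0 and j = -1 drop out, leaving six. *)
have p (x : int) : 0 <= x * x - x by nia.
have ha := p i%:Z; have hb := p (j%:Z - i%:Z + 1); have hc := p (k%:Z - j%:Z).
have q (x : int) : x * x - x = 0 -> (x == 0) || (x == 1) by nia.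
have a1 : (i%:Z == 0) || (i%:Z == 1) by apply: q; lia.
have b1 : (j%:Z - i%:Z + 1 == 0) || (j%:Z - i%:Z + 1 == 1) by apply: q; lia.
have c1 : (k%:Z - j%:Z == 0) || (k%:Z - j%:Z == 1) by apply: q; lia.
move: a1 b1 c1; clear; rewrite !inE !xpair_eqE; lia.
Qed.

Theorem theorem1p2 (R : realType) (q : R[i]) (hq : `|q| < 1) :
  has_sum3
    (fun i j k : nat =>
       q ^ (2 * i%:Z ^+ 2 + 2 * j%:Z ^+ 2 + k%:Z ^+ 2
            - 2 * i%:Z * j%:Z - 2 * j%:Z * k%:Z)
       / (qpoch (q ^+ 2) (q ^+ 2) i * qpoch (q ^+ 2) (q ^+ 2) j
          * qpoch (q ^+ 2) (q ^+ 2) k))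
    (etaJ q 4 ^+ 5 * etaJ q 40
       / (etaJ q 1 * etaJ q 2 ^+ 2 * etaJ q 8 ^+ 2 * thetaJ q 8 40)
     + 2 * q * (etaJ q 8 ^+ 2 * thetaJ q 6 20 * thetaJ q 8 40
       / (etaJ q 1 * etaJ q 4 ^+ 2 * etaJ q 40)))
  /\
  has_sum3
    (fun i j k : nat =>
       q ^ (i%:Z ^+ 2 + j%:Z ^+ 2 + ((k%:Z ^+ 2 + k%:Z) %/ 2)%Z
            - i%:Z * j%:Z - j%:Z * k%:Z)
       / (qpoch q q i * qpoch q q j * qpoch q q k))
    (etaJ q 2 ^+ 6 * thetaJ q 1 10 * thetaJ q 8 20
       / (etaJ q 1 ^+ 5 * etaJ q 4 ^+ 2 * etaJ q 20)
     + 2 * q * (etaJ q 4 ^+ 2 * thetaJ q 4 10 * thetaJ q 2 20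
       / (etaJ q 1 ^+ 3 * etaJ q 20)))
  /\
  has_sum3
    (fun i j k : nat =>
       q ^ (i%:Z ^+ 2 + j%:Z ^+ 2 + ((k%:Z ^+ 2 + k%:Z) %/ 2)%Z
            - i%:Z * j%:Z - j%:Z * k%:Z + i%:Z - j%:Z)
       / (qpoch q q i * qpoch q q j * qpoch q q k))
    (2 * (etaJ q 2 * etaJ q 4 ^+ 2 * etaJ q 20
       / (etaJ q 1 ^+ 3 * thetaJ q 4 20))
     + etaJ q 2 ^+ 6 * thetaJ q 3 10 * thetaJ q 4 20
       / (etaJ q 1 ^+ 5 * etaJ q 4 ^+ 2 * etaJ q 20))
  /\
  has_sum3
    (fun i j k : nat =>
       q ^ (2 * i%:Z ^+ 2 + 2 * j%:Z ^+ 2 + k%:Z ^+ 2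
            - 2 * i%:Z * j%:Z - 2 * j%:Z * k%:Z - 2 * i%:Z + 2 * j%:Z)
       / (qpoch (q ^+ 2) (q ^+ 2) i * qpoch (q ^+ 2) (q ^+ 2) j
          * qpoch (q ^+ 2) (q ^+ 2) k))
    (2 * (etaJ q 8 ^+ 2 * thetaJ q 2 20 * thetaJ q 16 40
       / (etaJ q 1 * etaJ q 4 ^+ 2 * etaJ q 40))
     + q * (etaJ q 4 ^+ 4 * thetaJ q 8 20 * thetaJ q 4 40
       / (etaJ q 1 * etaJ q 2 ^+ 2 * etaJ q 8 ^+ 2 * etaJ q 40)))
  /\
  has_sum3
    (fun i j k : nat =>
       q ^ (i%:Z ^+ 2 + j%:Z ^+ 2 + ((k%:Z ^+ 2 - k%:Z) %/ 2)%Z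
            - i%:Z * j%:Z - j%:Z * k%:Z - i%:Z + j%:Z)
       / (qpoch q q i * qpoch q q j * qpoch q q k))
    (4 * (etaJ q 2 * etaJ q 4 ^+ 2 * etaJ q 20
       / (etaJ q 1 ^+ 3 * thetaJ q 4 20))
     + 2 * (etaJ q 2 ^+ 6 * thetaJ q 3 10 * thetaJ q 4 20
       / (etaJ q 1 ^+ 5 * etaJ q 4 ^+ 2 * etaJ q 20)))
  /\
  (q != 0 ->
   has_sum3
    (fun i j k : nat =>
       q ^ (i%:Z ^+ 2 + j%:Z ^+ 2 + ((k%:Z ^+ 2 - k%:Z) %/ 2)%Z
            - i%:Z * j%:Z - j%:Z * k%:Z - 2 * i%:Z + 2 * j%:Z)
       / (qpoch q q i * qpoch q q j * qpoch q q k))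
    (2 * q^-1 * (etaJ q 2 ^+ 6 * thetaJ q 1 10 * thetaJ q 8 20
       / (etaJ q 1 ^+ 5 * etaJ q 4 ^+ 2 * etaJ q 20))
     + 4 * (etaJ q 4 ^+ 2 * thetaJ q 4 10 * thetaJ q 2 20
       / (etaJ q 1 ^+ 3 * etaJ q 20)))).
Proof.
have [q0|q0] := eqVneq q 0; last first.
  split; first exact: identity1.
  split; first exact: identity2.
  split; first exact: identity3.
  split; first exact: identity4.
  split; first exact: identity5.
  by move=> _; exact: identity6.
rewrite {}q0 {hq}.
have qpoch1 n : qpoch (0 : R[i]) 0 n = 1 := qpoch00 R n.
have qpoch2 n : qpoch ((0 : R[i]) ^+ 2) (0 ^+ 2) n = 1 by rewrite expr0n.
split.
  apply: (has_sum3_at0 (e := fun i j k => (2 * i%:Z ^+ 2 + 2 * j%:Z ^+ 2 + k%:Z ^+ 2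
            - 2 * i%:Z * j%:Z - 2 * j%:Z * k%:Z)) qpoch2 (l := [:: (0, 0, 0)]%N)
    isT (@zeros1)) => [t|].
    by rewrite !inE; do ?[case/orP]; move/eqP => ->.
  by rewrite !etaJ0 (thetaJ0 R (a := 7) (b := 31) (m := 40) erefl) (thetaJ0 R (a := 5) (b := 13) (m := 20) erefl) /=; field; rewrite ?oner_neq0.
split.
  apply: (has_sum3_at0 (e := fun i j k => (i%:Z ^+ 2 + j%:Z ^+ 2 + ((k%:Z ^+ 2 + k%:Z) %/ 2)%Z
            - i%:Z * j%:Z - j%:Z * k%:Z)) qpoch1 (l := [:: (0, 0, 0)]%N)
    isT (@zeros2)) => [t|].
    by rewrite !inE; do ?[case/orP]; move/eqP => ->.
  by rewrite !etaJ0 (thetaJ0 R (a := 0) (b := 8) (m := 10) erefl) (thetaJ0 R (a := 7) (b := 11) (m := 20) erefl) (thetaJ0 R (a := 3) (b := 5) (m := 10) erefl) (thetaJ0 R (a := 1) (b := 17) (m := 20) erefl) /=; field; rewrite ?oner_neq0.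
split.
  apply: (has_sum3_at0 (e := fun i j k => (i%:Z ^+ 2 + j%:Z ^+ 2 + ((k%:Z ^+ 2 + k%:Z) %/ 2)%Z
            - i%:Z * j%:Z - j%:Z * k%:Z + i%:Z - j%:Z)) qpoch1 (l := [:: (0, 0, 0); (0, 1, 0); (0, 1, 1)]%N)
    isT (@zeros3)) => [t|].
    by rewrite !inE; do ?[case/orP]; move/eqP => ->.
  by rewrite !etaJ0 (thetaJ0 R (a := 3) (b := 15) (m := 20) erefl) (thetaJ0 R (a := 2) (b := 6) (m := 10) erefl) /=; field; rewrite ?oner_neq0.
split.
  apply: (has_sum3_at0 (e := fun i j k => (2 * i%:Z ^+ 2 + 2 * j%:Z ^+ 2 + k%:Z ^+ 2
            - 2 * i%:Z * j%:Z - 2 * j%:Z * k%:Z - 2 * i%:Z + 2 * j%:Z)) qpoch2 (l := [:: (0, 0, 0); (1, 0, 0)]%N)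
    isT (@zeros4)) => [t|].
    by rewrite !inE; do ?[case/orP]; move/eqP => ->.
  by rewrite !etaJ0 (thetaJ0 R (a := 1) (b := 17) (m := 20) erefl) (thetaJ0 R (a := 15) (b := 23) (m := 40) erefl) (thetaJ0 R (a := 7) (b := 11) (m := 20) erefl) (thetaJ0 R (a := 3) (b := 35) (m := 40) erefl) /=; field; rewrite ?oner_neq0.
split.
  apply: (has_sum3_at0 (e := fun i j k => (i%:Z ^+ 2 + j%:Z ^+ 2 + ((k%:Z ^+ 2 - k%:Z) %/ 2)%Z
            - i%:Z * j%:Z - j%:Z * k%:Z - i%:Z + j%:Z)) qpoch1 (l := [:: (0, 0, 0); (1, 0, 0); (0, 0, 1); (1, 0, 1); (1, 1, 1); (1, 1, 2)]%N)
    isT (@zeros5)) => [t|].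
    by rewrite !inE; do ?[case/orP]; move/eqP => ->.
  by rewrite !etaJ0 (thetaJ0 R (a := 3) (b := 15) (m := 20) erefl) (thetaJ0 R (a := 2) (b := 6) (m := 10) erefl) /=; field; rewrite ?oner_neq0.
by [].
Qed.
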